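(* Let $X$ be a real Banach space and let its dual $X^*$ be endowed with an equivalent dual norm, with unit sphere $S_{X^*}$, such that $(S_{X^*},w^* )$ is semi-metrizable. Then $X^*$ admits an equivalent dual rotund norm.
   Context: An equivalent dual norm on $X^*$ is a norm that is the dual norm of some equivalent norm on $X$ (equivalently, an equivalent $w^*$-lower semicontinuous norm). A norm is rotund (strictly convex) if $\|x\|=\|y\|=\|(x+y)/2\|$ implies $x=y$. A symmetric on a nonempty set $T$ is a function $\rho:T\times T\to[0,+\infty)$ with $\rho(x,y)=\rho(y,x)$ for all $x,y\in T$, and $\rho(x,y)=0$ if and only if $x=y$ (no triangle inequality is assumed). Put $B_\rho(x,\varepsilon)=\{y\in T:\rho(x,y)<\varepsilon\}$. A topological space $T$ is semi-metrizable if there is a symmetric $\rho$ on $T$ such that (a) $U\subseteq T$ is open if and only if for every $x\in U$ there is $\varepsilon>0$ with $B_\rho(x,\varepsilon)\subseteq U$, and (b) for every $x\in T$ the balls $B_\rho(x,\varepsilon)$, $\varepsilon>0$, form a neighbourhood base at $x$. *)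

(* Defs.v *)
From HB Require Import structures.
From mathcomp Require Import all_boot all_order all_algebra.
From mathcomp Require Import all_classical all_reals all_analysis.

Set Implicit Arguments.
Unset Strict Implicit.
Unset Printing Implicit Defensive.

Import Order.TTheory GRing.Theory Num.Theory.
Import numFieldNormedType.Exports.

Local Open Scope classical_set_scope.
Local Open Scope ring_scope.

Definition is_norm (R : realType) (V : lmodType R) (N : V -> R) : Prop :=
  [/\ forall x y, N (x + y) <= N x + N y,
      forall (a : R) x, N (a *: x) = `|a| * N x &
      forall x, N x = 0 -> x = 0].

Definition equivalent_norm (R : realType) (X : normedModType R) (N : X -> R) :
    Prop :=
  is_norm N /\
  exists c C : R, [/\ 0 < c, 0 < C &
    forall x, c * `|x| <= N x /\ N x <= C * `|x|].

Definition rotund (R : realType) (V : lmodType R) (N : V -> R) : Prop :=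
  forall x y, N x = N y -> N y = N (2^-1 *: (x + y)) -> x = y.

Section dual.
Context {R : realType} (X : normedModType R).

Definition continuous_functional : {pred X -> R^o} :=
  mem [set f : X -> R^o | linear f /\ continuous f].

Lemma continuous_functionalP (f : X -> R^o) :
  f \in continuous_functional <-> linear f /\ continuous f.
Proof. by split => [/set_mem|/mem_set]. Qed.

Lemma continuous_functional_submod : submod_closed continuous_functional.
Proof.
split.
  apply/continuous_functionalP; split; last exact: cst_continuous.
  by move=> a x y; rewrite -[RHS]/(a *: 0 + 0) scaler0 addr0.
move=> a f g /continuous_functionalP[lf cf] /continuous_functionalP[lg cg].
apply/continuous_functionalP; split.
  move=> b x y; rewrite -[LHS]/(a *: f (b *: x + y) + g (b *: x + y)).
  rewrite -[RHS]/(b *: (a *: f x + g x) + (a *: f y + g y)).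
  by rewrite lf lg !scalerDr !scalerA (mulrC a b) addrACA.
move=> x; apply: cvgD; last exact: cg.
by apply: cvgZr; exact: cf.
Qed.

HB.instance Definition _ := GRing.isSubmodClosed.Build R (X -> R^o)
  continuous_functional continuous_functional_submod.

Record dual : Type := Dual {
  dual_fun :> X -> R^o;
  _ : dual_fun \in continuous_functional }.

HB.instance Definition _ := [isSub for dual_fun].
HB.instance Definition _ := [Choice of dual by <:].
HB.instance Definition _ := [SubChoice_isSubLmodule of dual by <:].

(* The w*-topology is pointwise convergence on X, so it is induced by the
   inclusion of the dual into the product R^X. *)
Definition weak_star : Type := dual.
HB.instance Definition _ := Topological.copy weak_star
  (initial_topology (dual_fun : dual -> {ptws X -> R^o})).

Definition dual_norm (N : X -> R) (f : dual) : R :=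
  sup [set `|f x| | x in [set x | N x <= 1]].

Definition equivalent_dual_norm (p : dual -> R) : Prop :=
  exists2 N : X -> R, equivalent_norm N & p = dual_norm N.

(* Its coercion [set_type] carries the relative w*-topology. *)
Definition dual_sphere (p : dual -> R) : set weak_star :=
  [set f : weak_star | p f = 1].

End dual.

Definition is_symmetric (R : realType) (T : Type) (rho : T -> T -> R) : Prop :=
  [/\ [set: T] !=set0,
      forall x y, 0 <= rho x y,
      forall x y, rho x y = rho y x &
      forall x y, rho x y = 0 <-> x = y].

Definition symmetric_ball (R : realType) (T : Type) (rho : T -> T -> R)
  (x : T) (e : R) : set T := [set y | rho x y < e].

Definition semi_metrizable (R : realType) (T : topologicalType) : Prop :=
  exists rho : T -> T -> R,
  [/\ is_symmetric rho,
      forall U : set T, open U <->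
        (forall x, U x -> exists2 e, 0 < e & symmetric_ball rho x e `<=` U),
      (forall x e, 0 < e -> nbhs x (symmetric_ball rho x e)) &
      (forall x (U : set T), nbhs x U ->
        exists2 e, 0 < e & symmetric_ball rho x e `<=` U)].

(* Main.v *)
Require Import Defs.
From HB Require Import structures.
From mathcomp Require Import all_boot all_order all_algebra.
From mathcomp Require Import all_classical all_reals all_analysis.
From mathcomp Require Import ring lra.

Set Implicit Arguments.
Unset Strict Implicit.
Unset Printing Implicit Defensive.

Import Order.TTheory GRing.Theory Num.Theory.
Import numFieldNormedType.Exports.

Local Open Scope classical_set_scope.
Local Open Scope ring_scope.

(** Write [p] for the given dual norm.  For an open cover [G] of its sphere, cut
    away from a w*-compact convex set all slices whose trace on the sphere lies
    in one member of [G].  Iterating from the ball of [p] eventually removes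
    every point of the sphere: otherwise the intersection [D] of the derived sets
    meets the sphere, and then [D] has an extreme point [e] on the sphere (the
    complement of a maximal proper relatively open convex subset of [D] that
    contains [D] intersected with the open unit ball).  Slices form a w*-base at
    [e] in [D], so by compactness a slice around [e] was already cut away at some
    stage.

    The balls of radius [1/n] of the semi-metric give covers [G n] such that two
    distinct points of the sphere lie in no common member of [G n] for [n]
    large.  Let [q] be an l2-combination of [p] and of countably many seminorms
    that record, for each [n] and each stage, how far a functional reaches into
    the slices.  If [q x = q y = q ((x + y) / 2)] then all these seminorms agree
    at [x], [y] and their midpoint, so all three leave the derived sets at the
    same stage and a slice that nearly attains the seminorm at the midpoint
    contains both [x] and [y] (or both [- x] and [- y]); hence [x = y]. *)

(** * Convex sets and directed covers of compact sets *)

Definition convex_in (R : realType) (V : lmodType R) (A : set V) :=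
  forall u v (t : R), A u -> A v -> 0 <= t -> t <= 1 ->
    A (t *: u + (1 - t) *: v).

(** If no [O i] covered [K], the sets [K] minus [O i] would generate a proper filter by
    directedness. Its cluster point in [K] lies in some open [O i], which is impossible. *)
Lemma compact_directed_cover (T : topologicalType) (K : set T) (I : Type)
    (D : set I) (O : I -> set T) :
  compact K -> D !=set0 -> (forall i, D i -> open (O i)) ->
  (forall i j, D i -> D j ->
    exists2 k, D k & O i `|` O j `<=` O k) ->
  K `<=` \bigcup_(i in D) O i -> exists2 i, D i & K `<=` O i.
Proof.
move=> cK D0 oO dirO KO; apply: contrapT => noK.
pose F := filter_from D (fun i => K `\` O i).
have FF : Filter F.
  apply: filter_from_filter => // i j Di Dj.
  have [k Dk ijk] := dirO i j Di Dj; exists k => //.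
  by move=> x [Kx nOk]; split; split=> // Ox; apply/nOk/ijk; [left|right].
have PF : ProperFilter F.
  apply: filter_from_proper => // i Di; apply/set0P/negP => /eqP E.
  apply: noK; exists i => // x Kx; apply: contrapT => nO.
  by have : (set0 : set T) x by rewrite -E.
have FK : F K by case: D0 => i Di; exists i => // x [].
have [x [Kx clx]] := cK _ PF FK; have [i Di Ox] := KO x Kx.
have Fi : F (K `\` O i) by exists i.
have [y [[_ nO] Oy]] := clx _ _ Fi (open_nbhs_nbhs (conj (oO i Di) Ox)).
exact: nO.
Qed.

(** * The w*-topology *)

Section WeakStar.
Context {R : realType} {X : normedModType R}.
Implicit Types (f g h : weak_star X) (x : X) (a b : X).

(* Retyped at R: functionals take values in R^o, whose ring structure is not
   syntactically that of R. *)
Definition ev (h : dual X) (a : X) : R := h a.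

Lemma weak_star_eq f g : (forall x, ev f x = ev g x) -> f = g.
Proof. by move=> fg; apply: val_inj; apply/funext => x; exact: fg. Qed.

Lemma evDl f g x : ev (f + g) x = ev f x + ev g x. Proof. by []. Qed.
Lemma evZl (c : R) f x : ev (c *: f) x = c * ev f x. Proof. by []. Qed.
Lemma evNl f x : ev (- f) x = - ev f x. Proof. by []. Qed.
Lemma ev0l x : ev 0 x = 0. Proof. by []. Qed.

Lemma ev_linear (f : dual X) (c : R) a b : ev f (c *: a + b) = c * ev f a + ev f b.
Proof. by have /continuous_functionalP[+ _] := valP f; exact. Qed.

Lemma ev_continuous_r (f : dual X) : continuous (ev f).
Proof. by have /continuous_functionalP[] := valP f. Qed.

Lemma ev0r (f : dual X) : ev f 0 = 0.
Proof. by have := ev_linear f 1 0 0; rewrite scaler0 addr0 mul1r; lra. Qed.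
Lemma evDr (f : dual X) a b : ev f (a + b) = ev f a + ev f b.
Proof. by rewrite -[a in LHS]scale1r ev_linear mul1r. Qed.
Lemma evZr (f : dual X) (c : R) a : ev f (c *: a) = c * ev f a.
Proof. by rewrite -[c *: a]addr0 ev_linear ev0r addr0. Qed.
Lemma evNr (f : dual X) a : ev f (- a) = - ev f a.
Proof. by rewrite -scaleN1r evZr mulN1r. Qed.

Lemma weak_star_neq_lt f g : f <> g -> exists b, ev f b < ev g b.
Proof.
move=> fg; apply: contrapT => no; apply: fg; apply: weak_star_eq => b.
apply/eqP; rewrite eq_le; apply/andP; split; rewrite leNgt; apply/negP => lt.
  by apply: no; exists (- b); rewrite !evNr ltrN2.
by apply: no; exists b.
Qed.

Lemma cvg_weak_star (F : set_system (weak_star X)) g : Filter F ->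
  F --> g <-> forall x, (fun h => ev h x) @ F --> (ev g x).
Proof.
move=> FF.
pose d : weak_star X -> {ptws X -> R^o} := @dual_fun R X.
have -> : (F --> g) <-> (d @ F --> d g).
  split=> [Fg|dFg].
    apply: cvg_trans (@initial_continuous _ _ d g).
    exact: cvg_app.
  move=> A /= [_ [[B Bop <-] Bfs sBfA]].
  apply: (filterS sBfA); apply: dFg; exact: open_nbhs_nbhs.
exact: (@pointwise_cvgP X R^o (d @ F) (d g)).
Qed.

Lemma ev_continuous x : continuous (fun h : weak_star X => ev h x).
Proof. by move=> g; exact: ((cvg_weak_star g (nbhs_filter g)).1 (@cvg_id _ _) x). Qed.

Lemma weak_star_continuous (T : topologicalType) (phi : T -> weak_star X) :
  (forall x, continuous (fun t => ev (phi t) x)) -> continuous phi.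
Proof.
move=> cphi t; apply/(cvg_weak_star (F := phi @ t)) => x.
exact: (cphi x t).
Qed.

(** The basic sets generate a filter that converges to [g] at each point of [X], hence in the
    w*-topology, so every neighbourhood contains one of them. *)
Lemma nbhs_weak_star g (U : set (weak_star X)) : nbhs g U ->
  exists2 s : seq X * R, 0 < s.2 &
    forall h, (forall a, a \in s.1 -> `|ev h a - ev g a| < s.2) -> U h.
Proof.
pose F := filter_from [set s : seq X * R | 0 < s.2]
  (fun s => [set h : weak_star X | forall a, a \in s.1 -> `|ev h a - ev g a| < s.2]).
have FF : Filter F.
  apply: filter_from_filter; first by exists ([::], 1) => /=.
  move=> [s e] [s' e'] /= e0 e'0; exists (s ++ s', Num.min e e').
    by rewrite /= lt_min e0.
  move=> h /= hh; split=> a sa; have := hh a; rewrite mem_cat sa ?orbT lt_min.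
    by move=> /(_ isT)/andP[].
  by move=> /(_ isT)/andP[].
suff /[apply] : F --> g by [].
apply/cvg_weak_star => x; apply/cvgrPdist_lt => e e0; exists ([:: x], e) => //.
by move=> h /= /(_ x); rewrite inE eqxx distrC => /(_ isT).
Qed.

Lemma open_ev_lt a (c : R) : open [set h : weak_star X | ev h a < c].
Proof.
exact: (open_comp (fun g _ => @ev_continuous a g) (@open_lt R c)).
Qed.

Lemma open_ev_gt a (c : R) : open [set h : weak_star X | c < ev h a].
Proof.
exact: (open_comp (fun g _ => @ev_continuous a g) (@open_gt R c)).
Qed.

Lemma closed_ev_le a (c : R) : closed [set h : weak_star X | ev h a <= c].
Proof.
exact: (closed_comp (fun g _ => @ev_continuous a g) (@closed_le R c)).
Qed.

Lemma closed_ev_ge a (c : R) : closed [set h : weak_star X | c <= ev h a].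
Proof.
exact: (closed_comp (fun g _ => @ev_continuous a g) (@closed_ge R c)).
Qed.

Lemma weak_star_hausdorff : hausdorff_space (weak_star X).
Proof.
move=> f g clfg; apply: weak_star_eq => x.
apply: (@Rhausdorff R) => A B /ev_continuous fA /ev_continuous gB.
by have [h [? ?]] := clfg _ _ fA gB; exists (ev h x).
Qed.

Lemma conv_continuous : continuous
  (fun z : weak_star X * weak_star X * R =>
     z.2 *: z.1.1 + (1 - z.2) *: z.1.2 : weak_star X).
Proof.
apply: weak_star_continuous => x.
rewrite (_ : (fun _ => _) = (fun z : weak_star X * weak_star X * R =>
  z.2 * (ev z.1.1 x) + (1 - z.2) * (ev z.1.2 x))) // => z.
have ev (k : weak_star X * weak_star X * R -> weak_star X) :
    k @ z --> k z -> (fun y => ev (k y) x) @ z --> (ev (k z) x).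
  move=> kz; apply: (cvg_comp k (fun h : weak_star X => ev h x) kz).
  exact: ev_continuous.
have c11 : (fun y : weak_star X * weak_star X * R => y.1.1) @ z --> z.1.1.
  exact: (cvg_comp fst fst cvg_fst cvg_fst).
have c12 : (fun y : weak_star X * weak_star X * R => y.1.2) @ z --> z.1.2.
  exact: (cvg_comp fst snd cvg_fst cvg_snd).
apply: cvgD; apply: cvgM.
- exact: cvg_snd.
- exact: ev c11.
- by apply: cvgB; [exact: cvg_cst|exact: cvg_snd].
- exact: ev c12.
Qed.

(** For nonempty convex [A] and [B] this is the convex hull of the union; it is empty as soon as one
    of them is. *)
Definition joined (A B : set (weak_star X)) : set (weak_star X) :=
  [set h | exists u v t, [/\ A u, B v, 0 <= t, t <= 1 &
    h = (t *: u + (1 - t) *: v)]].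

Lemma compact_joined (A B : set (weak_star X)) :
  compact A -> compact B -> compact (joined A B).
Proof.
move=> cA cB.
have -> : joined A B = (fun z : weak_star X * weak_star X * R =>
     z.2 *: z.1.1 + (1 - z.2) *: z.1.2 : weak_star X) @`
     ((A `*` B) `*` `[0, 1]).
  apply/seteqP; split=> [h [u [v [t [Au Bv t0 t1 ->]]]]|h].
    by exists (u, v, t) => //=; split=> //=; rewrite in_itv /= t0.
  move=> [[[u v] t] [[/= Au Bv]]]; rewrite in_itv /= => /andP[t0 t1] <-.
  by exists u, v, t.
apply: continuous_compact; first exact/continuous_subspaceT/conv_continuous.
apply: compact_setX; first exact: compact_setX.
exact: segment_compact.
Qed.

(** A mixture of two such points is regrouped into its [A] part and its [B] part, of total weights
    [m] and [1 - m]. *)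
Lemma convex_joined (A B : set (weak_star X)) :
  convex_in A -> convex_in B -> convex_in (joined A B).
Proof.
move=> cA cB _ _ t [u [v [s [Au Bv s0 s1 ->]]]] [u' [v' [s' [Au' Bv' s'0 s'1 ->]]]] t0 t1.
pose m := t * s + (1 - t) * s'.
have m0 : 0 <= m by rewrite addr_ge0 // mulr_ge0 // subr_ge0.
have m'0 : 0 <= 1 - m.
  have -> : 1 - m = t * (1 - s) + (1 - t) * (1 - s') by rewrite /m; ring.
  by rewrite addr_ge0 // mulr_ge0 // subr_ge0.
(* Renormalises two nonnegative weights; when both vanish any point of [C] serves. *)
have cmb (C : set (weak_star X)) : convex_in C ->
    forall w w' (p p' : R), C w -> C w' -> 0 <= p -> 0 <= p' ->
    exists2 w'', C w'' & (p + p') *: w'' = p *: w + p' *: w'.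
  move=> cC w w' p p' Cw Cw' p0 p'0.
  have [pp|pp] := eqVneq (p + p') 0.
    have [-> ->] : p = 0 /\ p' = 0 by split; lra.
    by exists w => //; rewrite addr0 !scale0r addr0.
  exists ((p / (p + p')) *: w + (1 - p / (p + p')) *: w').
    apply: cC => //; first by rewrite divr_ge0 // addr_ge0.
    by rewrite ler_pdivrMr ?mul1r ?lerDl // lt0r pp addr_ge0.
  have -> : 1 - p / (p + p') = p' / (p + p').
    by rewrite -[in LHS](divff pp) -mulrBl addrC addKr.
  by rewrite scalerDr !scalerA ![(p + p') * _]mulrC !divfK.
have [||w Aw Ew] := cmb A cA u u' (t * s) ((1 - t) * s') Au Au'.
- by rewrite mulr_ge0.
- by rewrite mulr_ge0 // subr_ge0.
have [||z Bz Ez] := cmb B cB v v' (t * (1 - s)) ((1 - t) * (1 - s')) Bv Bv'.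
- by rewrite mulr_ge0 // subr_ge0.
- by rewrite mulr_ge0 // subr_ge0.
exists w, z, m; split=> //; first by rewrite -subr_ge0.
have -> : 1 - m = t * (1 - s) + (1 - t) * (1 - s') by rewrite /m; ring.
rewrite Ez Ew !scalerDr !scalerA.
by rewrite addrACA.
Qed.

Lemma joined_subl A B v : B v -> A `<=` joined A B.
Proof.
move=> Bv u Au; exists u, v, 1; split=> //.
by rewrite subrr scale1r scale0r addr0.
Qed.

Lemma joined_subr A B u : A u -> B `<=` joined A B.
Proof.
move=> Au v Bv; exists u, v, 0; split=> //.
by rewrite subr0 scale1r scale0r add0r.
Qed.

Lemma joined_sub (D A B : set (weak_star X)) : convex_in D -> A `<=` D -> B `<=` D ->
  joined A B `<=` D.
Proof. by move=> cD AD BD _ [u [v [t [/AD Du /BD Dv t0 t1 ->]]]]; exact: cD. Qed.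

(* Minimise the squared distance to g in finitely many coordinates that
   already separate g from C. *)
Lemma weak_star_separation (C : set (weak_star X)) g :
  compact C -> convex_in C -> ~ C g ->
  exists a (c : R), (forall h, C h -> ev h a < c) /\ c < ev g a.
Proof.
move=> cC vC nCg.
have [C0|/set0P C0] := eqVneq C set0.
  by exists 0, (-1); split=> [h|]; rewrite ?C0 // ev0r ltrN10.
have oC : nbhs g (~` C).
  apply: open_nbhs_nbhs; split=> //; apply: closed_openC.
  exact: (compact_closed weak_star_hausdorff).
have [[s e] /= e0 sC] := nbhs_weak_star oC.
pose phi h : R := \sum_(a <- s) (ev h a - ev g a) ^+ 2.
have cphi : continuous phi.
  rewrite /phi; elim: s {sC phi} => [|a s IH].
    rewrite (_ : (fun _ => _) = cst 0); first exact: cst_continuous.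
    by apply/funext => h; rewrite big_nil.
  rewrite (_ : (fun _ => _) = (fun h => (ev h a - ev g a) * (ev h a - ev g a) +
      \sum_(a <- s) (ev h a - ev g a) ^+ 2)); last first.
    by apply/funext => h; rewrite big_cons expr2.
  move=> h; apply: cvgD (IH h).
  by apply: cvgM; (apply: cvgB; [exact: ev_continuous|exact: cvg_cst]).
have [h0 /set_mem Ch0 minh0] :=
  compact_EVT_min C0 cC (continuous_subspaceT cphi).
have phi0 : 0 < phi h0.
  rewrite lt_neqAle sumr_ge0 ?andbT => [|a _]; last exact: sqr_ge0.
  apply/eqP => /esym/eqP; rewrite psumr_eq0 => [/allP all0|a _]; last exact: sqr_ge0.
  apply: (sC h0) => // a /all0; rewrite sqrf_eq0 => /eqP ->.
  by rewrite normr0.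
(* Half the gradient of [phi] at the minimiser [h0], read as a point of [X]. *)
pose b := \sum_(a <- s) (ev h0 a - ev g a) *: a.
have bE h : ev h b = \sum_(a <- s) (ev h0 a - ev g a) * ev h a.
  rewrite /b; elim: s {sC phi cphi minh0 phi0 b} => [|a s IH].
    by rewrite !big_nil ev0r.
  by rewrite !big_cons evDr evZr IH.
(* First-order condition: moving from [h0] towards [h] cannot decrease [phi]. *)
have var h : C h -> 0 <= ev h b - ev h0 b.
  move=> Ch; rewrite leNgt; apply/negP => neg.
  pose m := ev h b - ev h0 b; pose q := \sum_(a <- s) (ev h a - ev h0 a) ^+ 2.
  have q0 : 0 <= q by apply: sumr_ge0 => a _; exact: sqr_ge0.
  have expand t : phi (t *: h + (1 - t) *: h0) =
      phi h0 + (2 * t * m + t ^+ 2 * q).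
    rewrite /phi /m !bE -sumrB /q !mulr_sumr -!big_split.
    have pe a : (ev (t *: h + (1 - t) *: h0) a - ev g a) ^+ 2 =
        (ev h0 a - ev g a) ^+ 2 +
        (2 * t * ((ev h0 a - ev g a) * ev h a - (ev h0 a - ev g a) * ev h0 a) +
         t ^+ 2 * (ev h a - ev h0 a) ^+ 2).
      by rewrite evDl !evZl; ring.
    by apply: eq_bigr => a _; exact: pe.
  have m0 : m < 0 by [].
  (* With [t * (q + 1) <= - m] one gets [2 * m + t * q <= m < 0], so [phi] would drop below its
     minimum. *)
  pose t := Num.min 1 (- m / (q + 1)).
  have q1 : 0 < q + 1 by rewrite ltr_wpDl.
  have t0 : 0 < t by rewrite lt_min ltr01 divr_gt0 // oppr_gt0.
  have t1 : t <= 1 by rewrite ge_min lexx.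
  have tq : t * (q + 1) <= - m by rewrite -ler_pdivlMr // ge_min lexx orbT.
  have ht : t *: h + (1 - t) *: h0 \in C by apply/mem_set/vC => //; exact: ltW.
  have := minh0 _ ht; rewrite expand => le.
  have tm : 0 <= t * (2 * m + t * q).
    have -> : t * (2 * m + t * q) = 2 * t * m + t ^+ 2 * q by ring.
    by rewrite -(lerDl (phi h0)).
  by have := pmulr_rge0 (2 * m + t * q) t0; rewrite tm => /esym; nra.
have gb : ev h0 b - ev g b = phi h0.
  rewrite !bE -sumrB; apply: eq_bigr => a _; ring.
exists (- b), (- ((ev h0 b + ev g b) / 2)); split=> [h /var|]; rewrite evNr; lra.
Qed.

End WeakStar.

(** * Dual norms *)

Section DualNorm.
Context {R : realType} {X : normedModType R}.
Implicit Types (f g h : weak_star X) (x : X) (a b : X).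

Lemma linear_bounded_dual (u : X -> R) (C : R) : 0 < C ->
  (forall (c : R) x y, u (c *: x + y) = c * u x + u y) ->
  (forall x, `|u x| <= C * `|x|) ->
  exists f : weak_star X, forall x, ev f x = u x.
Proof.
move=> C0 lu bu.
have uB x y : u (x - y) = u x - u y.
  by rewrite addrC -scaleN1r lu mulN1r addrC.
have cu : continuous (u : X -> R^o).
  move=> x; apply/cvgrPdist_lt => e e0.
  near=> y; rewrite -uB (le_lt_trans (bu _)) // mulrC -ltr_pdivlMr //.
  near: y; apply: cvgr_dist_lt => //; exact: divr_gt0.
have du : (u : X -> R^o) \in @continuous_functional R X.
  by apply/continuous_functionalP; split.
by exists (Dual du).
Unshelve. all: by end_near. Qed.

Lemma dual_bounded (f : dual X) :
  exists2 C : R, 0 < C & forall x, `|ev f x| <= C * `|x|.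
Proof.
have /cvgrPdist_lt /(_ 1 ltr01) /nbhs_norm0P [d /= d0 hd] :
  ev f @ 0 --> ev f 0 by exact: ev_continuous_r.
have d2 : 0 < d / 2 by rewrite divr_gt0.
exists (2 / d) => [|x]; first by rewrite divr_gt0.
have [->|x0] := eqVneq x 0; first by rewrite ev0r !normr0 mulr0.
have nx : 0 < `|x| by rewrite normr_gt0.
have := hd ((d / 2 / `|x|) *: x).
rewrite /= normrZ ger0_norm ?(ltW (divr_gt0 _ _)) // divfK ?gt_eqF //.
rewrite ev0r sub0r normrN evZr normrM ger0_norm ?(ltW (divr_gt0 _ _)) //.
have -> : (d / 2 < d) by lra.
move=> /(_ isT) lt1.
have -> : `|ev f x| = d / 2 / `|x| * `|ev f x| * (2 / d * `|x|).
  by field; rewrite !gt_eqF.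
by rewrite ler_piMl ?(ltW lt1) // mulr_ge0 // divr_ge0 // ltW.
Qed.

Context (N : X -> R) (hN : equivalent_norm N).

Lemma norm_zero : N 0 = 0.
Proof. by have [[_ NZ _] _] := hN; rewrite -(scale0r 0) NZ normr0 mul0r. Qed.

Lemma norm_ge0 x : 0 <= N x.
Proof.
have [_ [c [C [c0 _ /(_ x)[le _]]]]] := hN.
by rewrite (le_trans _ le) // mulr_ge0 // ltW.
Qed.

Lemma normZ (c : R) x : N (c *: x) = `|c| * N x.
Proof. by have [[_ -> _] _] := hN. Qed.

Lemma dual_norm_sup f : has_sup [set `|f x| | x in [set x | N x <= 1]].
Proof.
split; first by exists `|f 0|, 0; rewrite /= ?norm_zero.
have [C C0 bC] := dual_bounded f.
have [_ [c [D [c0 _ cN]]]] := hN.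
exists (C / c) => _ [x /= Nx <-]; rewrite (le_trans (bC x)) // ler_pM2l //.
by rewrite -[leRHS]mul1r ler_pdivlMr // mulrC (le_trans (cN x).1).
Qed.

Lemma dual_norm_le f (M : R) :
  (forall x, N x <= 1 -> `|ev f x| <= M) -> dual_norm N f <= M.
Proof.
move=> le; apply: ge_sup; first by case: (dual_norm_sup f).
by move=> _ [x Nx <-]; exact: le.
Qed.

Lemma le_dual_norm f x : N x <= 1 -> `|ev f x| <= dual_norm N f.
Proof.
by move=> Nx; apply: ub_le_sup; [case: (dual_norm_sup f)|exists x].
Qed.

Lemma ev_le f x : `|ev f x| <= dual_norm N f * N x.
Proof.
have [Nx0|Nx0] := eqVneq (N x) 0.
  by have [[_ _ /(_ x Nx0) ->] _] := hN; rewrite ev0r norm_zero mulr0 normr0.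
have Nx : 0 < N x by rewrite lt0r Nx0 norm_ge0.
rewrite -ler_pdivrMr //.
have := @le_dual_norm f ((N x)^-1 *: x).
rewrite normZ evZr normrM ger0_norm ?invr_ge0 ?norm_ge0 // mulVf // lexx.
by rewrite mulrC; exact.
Qed.

Lemma dual_norm_ge0 f : 0 <= dual_norm N f.
Proof. by rewrite (le_trans (normr_ge0 (ev f 0))) // le_dual_norm ?norm_zero. Qed.

Lemma dual_normZ (c : R) f : dual_norm N (c *: f) = `|c| * dual_norm N f.
Proof.
have le (d : R) g : dual_norm N (d *: g) <= `|d| * dual_norm N g.
  apply: dual_norm_le => x Nx; rewrite evZl normrM ler_wpM2l //.
  exact: le_dual_norm.
apply/eqP; rewrite eq_le le /=.
have [->|c0] := eqVneq c 0; first by rewrite normr0 mul0r dual_norm_ge0.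
rewrite -ler_pdivlMl ?normr_gt0 // -normfV.
by have := le c^-1 (c *: f); rewrite scalerA mulVf // scale1r.
Qed.

Lemma dual_normD f g : dual_norm N (f + g) <= dual_norm N f + dual_norm N g.
Proof.
apply: dual_norm_le => x Nx; rewrite evDl (le_trans (ler_normD _ _)) //.
by apply: lerD; exact: le_dual_norm.
Qed.

Lemma dual_norm_eq0 f : dual_norm N f = 0 -> f = 0.
Proof.
move=> f0; apply: weak_star_eq => x; apply/eqP; rewrite ev0l -normr_le0.
by have := ev_le f x; rewrite f0 mul0r.
Qed.

Lemma dual_norm_conv u v (t : R) : 0 <= t -> t <= 1 ->
  dual_norm N (t *: u + (1 - t) *: v) <=
  t * dual_norm N u + (1 - t) * dual_norm N v.
Proof.
move=> t0 t1; rewrite (le_trans (dual_normD _ _)) // !dual_normZ.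
by rewrite !ger0_norm // subr_ge0.
Qed.

(** Banach-Alaoglu: along an ultrafilter each evaluation stays in a compact segment and so
    converges; the pointwise limit is linear and obeys the same bound. *)
Lemma compact_dual_ball (r : R) :
  compact [set h : weak_star X | dual_norm N h <= r].
Proof.
have [r0|r0] := ltP r 0.
  rewrite (_ : mkset _ = set0); first exact: compact0.
  by apply/seteqP; split=> // h /=; have := dual_norm_ge0 h; lra.
rewrite compact_ultra => F UF FB.
have PF : ProperFilter F by exact: ultra_proper.
have cl x : exists l : R, `|l| <= r * N x /\ (fun h => ev h x) @ F --> l.
  pose K : set R := `[- (r * N x), r * N x]%classic.
  have cK : compact K by exact: segment_compact.
  have FK : F [set h | K (ev h x)].
    apply: filterS FB => h /= hr; rewrite /K /= in_itv /= -ler_norml.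
    by rewrite (le_trans (ev_le h x)) // ler_wpM2r // norm_ge0.
  have [l [Kl cll]] := cK _ (fmap_proper_filter (fun h => ev h x) PF) FK.
  have Fl : (fun h => ev h x) @ F --> l.
    move=> A lA; have [//|nA] := in_ultra_setVsetC [set h | A (ev h x)] UF.
    by have [y []] := cll (~` A) A nA lA.
  by exists l; split=> //; move: Kl; rewrite /K /= in_itv /= -ler_norml.
have [u hu] := choice cl.
have lu (c : R) x y : u (c *: x + y) = c * u x + u y.
  apply: (@cvg_unique _ (@Rhausdorff R) _ (fmap_proper_filter _ PF)).
    exact: (hu _).2.
  rewrite (_ : (fun _ => _) = (fun h => c * ev h x + ev h y)); last first.
    by apply/funext => h; rewrite ev_linear.
  apply: cvgD (hu y).2; apply: cvgM (hu x).2; exact: cvg_cst.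
have [_ [c [C [c0 C0 cN]]]] := hN.
(* The factor [r + 1] instead of [r] keeps the constant positive when [r = 0]. *)
have [||f fu] := @linear_bounded_dual u ((r + 1) * C) _ lu.
- by rewrite mulr_gt0 // ltr_wpDl.
- move=> x; rewrite (le_trans (hu x).1) // -mulrA.
  rewrite (le_trans (ler_wpM2l r0 (cN x).2)) // ler_wpM2r ?lerDl //.
  by rewrite mulr_ge0 // ltW.
exists f; split.
  apply: dual_norm_le => x Nx; rewrite fu (le_trans (hu x).1) //.
  by rewrite ler_piMr.
by apply/cvg_weak_star => x; rewrite fu; exact: (hu x).2.
Qed.

End DualNorm.

(** * Slices and maximal open convex sets *)

Section Convexity.
Context {R : realType} {X : normedModType R}.
Implicit Types (f g h u v : weak_star X) (x : X) (a b : X).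
Implicit Types (A B D O U : set (weak_star X)).

Lemma convex_inI A B : convex_in A -> convex_in B -> convex_in (A `&` B).
Proof.
move=> cA cB u v t [Au Bu] [Av Bv] t0 t1.
by split; [exact: cA|exact: cB].
Qed.

Lemma ev_conv u v (t : R) a :
  ev (t *: u + (1 - t) *: v) a = t * ev u a + (1 - t) * ev v a.
Proof. by []. Qed.

Lemma convex_ev_le a (c : R) : convex_in [set h : weak_star X | ev h a <= c].
Proof. by move=> u v t; rewrite /mkset ev_conv => ua va t0 t1; nra. Qed.

Lemma convex_ev_ge a (c : R) : convex_in [set h : weak_star X | c <= ev h a].
Proof. by move=> u v t; rewrite /mkset ev_conv => ua va t0 t1; nra. Qed.

Lemma separation_joined A B g : compact A -> compact B ->
  convex_in A -> convex_in B -> ~ A g -> ~ B g -> ~ joined A B g ->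
  exists a (c : R), (forall h, A h \/ B h -> ev h a < c) /\ c < ev g a.
Proof.
move=> kA kB cA cB nA nB nAB.
(* Empty pieces are treated apart, since then [joined A B] no longer contains the other piece. *)
have [A0|/set0P[u0 Au0]] := eqVneq A set0.
  have [a [c [lt gt]]] := weak_star_separation kB cB nB.
  by exists a, c; split=> // h; rewrite A0 => -[//|]; exact: lt.
have [B0|/set0P[v0 Bv0]] := eqVneq B set0.
  have [a [c [lt gt]]] := weak_star_separation kA cA nA.
  by exists a, c; split=> // h; rewrite B0 => -[|//]; exact: lt.
have [a [c [lt gt]]] :=
  weak_star_separation (compact_joined kA kB) (convex_joined cA cB) nAB.
exists a, c; split=> // h [Ah|Bh]; apply: lt.
  exact: (joined_subl Bv0).
exact: (joined_subr Au0).
Qed.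

(** The convexity of [D] without [e] makes [e] an extreme point: two compact convex pieces of [D]
    that miss [e] have a hull that misses [e], so one functional separates [e] from both. Induction
    runs over the coordinates of a basic neighbourhood. *)
Lemma slice_nbhs D e U : compact D -> convex_in D -> convex_in (D `\ e) ->
  D e -> nbhs e U ->
  exists a (c : R), c < ev e a /\ forall h, D h -> c < ev h a -> U h.
Proof.
move=> kD cD cDe De /nbhs_weak_star[[s eps] /= eps0 sU].
suff: exists a (c : R), c < ev e a /\ forall h, D h -> c < ev h a ->
    forall b, b \in s -> `|ev h b - ev e b| < eps.
  by move=> [a [c [ce hc]]]; exists a, c; split=> // h Dh /(hc h Dh)/sU.
elim: s {sU} => [|b s [a [c [ce hc]]]].
  by exists 0, (-1); rewrite ev0r ltrN10.
have joinD A B : A `<=` D `\ e -> B `<=` D `\ e ->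
    [/\ ~ A e, ~ B e & ~ joined A B e].
  move=> AD BD; split=> [/AD[_ ]|/BD[_]|]; [exact|exact|].
  by move=> /(joined_sub cDe AD BD)[_]; exact.
have sliceD A : closed A -> convex_in A -> ~ A e ->
    [/\ compact (D `&` A), convex_in (D `&` A) & D `&` A `<=` D `\ e].
  move=> clA cA nA; split; [exact: compact_closedI|exact: convex_inI|].
  by move=> h [Dh Ah]; split=> // he; apply: nA; rewrite -he.
(* The pieces of [D] where coordinate [b] is too small or too large by at least [eps]. *)
have [|k1 c1 D1] := sliceD _ (@closed_ev_le _ _ b (ev e b - eps))
  (@convex_ev_le b (ev e b - eps)) => [/=|]; first lra.
have [|k2 c2 D2] := sliceD _ (@closed_ev_ge _ _ b (ev e b + eps))
  (@convex_ev_ge b (ev e b + eps)) => [/=|]; first lra.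
have [n1 n2 n12] := joinD _ _ D1 D2.
have [a' [c' [lt' ce']]] := separation_joined k1 k2 c1 c2 n1 n2 n12.
(* Separating [e] from the complements of two slices yields one slice inside both. *)
have [|k3 c3 D3] := sliceD _ (@closed_ev_le _ _ a c)
  (@convex_ev_le a c) => [/=|]; first lra.
have [|k4 c4 D4] := sliceD _ (@closed_ev_le _ _ a' c')
  (@convex_ev_le a' c') => [/=|]; first lra.
have [n3 n4 n34] := joinD _ _ D3 D4.
have [a2 [c2' [lt2 ce2]]] := separation_joined k3 k4 c3 c4 n3 n4 n34.
exists a2, c2'; split=> // h Dh h2.
have ha : c < ev h a.
  by rewrite ltNge; apply/negP => le; have := lt2 h (or_introl (conj Dh le)); lra.
have ha' : c' < ev h a'.
  by rewrite ltNge; apply/negP => le; have := lt2 h (or_intror (conj Dh le)); lra.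
move=> b'; rewrite inE => /predU1P[->|]; last exact: hc.
rewrite ltr_norml; apply/andP; split; rewrite ltNge; apply/negP => le.
  by have := lt' h (or_introl (conj Dh _)); rewrite /mkset; lra.
by have := lt' h (or_intror (conj Dh _)); rewrite /mkset; lra.
Qed.

Lemma convex_bigcup_chain (F : set (set (weak_star X))) O D :
  (forall A, F A -> convex_in ((A `|` O) `&` D)) -> F !=set0 ->
  total_on F subset -> convex_in ((\bigcup_(A in F) A `|` O) `&` D).
Proof.
move=> cF [A0 FA0] tot.
have pick h : (\bigcup_(A in F) A `|` O) h -> exists2 A, F A & (A `|` O) h.
  by move=> [[A FA Ah]|Oh]; [exists A => //; left|exists A0 => //; right].
have up A B h : A `<=` B -> (A `|` O) h -> (B `|` O) h.
  by move=> AB [/AB|]; [left|right].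
have inF A h : F A -> (A `|` O) h -> (\bigcup_(A in F) A `|` O) h.
  by move=> FA [Ah|]; [left; exists A|right].
move=> u v t [/pick[A FA Au] Du] [/pick[B FB Bv] Dv] t0 t1.
have [C [FC Cu Cv]] : exists C, [/\ F C, (C `|` O) u & (C `|` O) v].
  by case: (tot A B FA FB) => [AB|BA]; [exists B|exists A]; split=> //;
    apply: up; eassumption.
by have [/(inF _ _ FC)] := cF C FC u v t (conj Cu Du) (conj Cv Dv) t0 t1.
Qed.

(** Zorn's lemma applies because [D] is compact: if the union of a chain covered [D], a single
    member of the chain would. *)
Lemma maximal_open_convex D O k0 : compact D -> open O ->
  convex_in (O `&` D) -> D k0 -> ~ O k0 ->
  exists M, [/\ open M, O `<=` M, convex_in (M `&` D), ~ (D `<=` M) &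
    forall M', open M' -> M `<=` M' -> convex_in (M' `&` D) ->
      D `<=` M' \/ M' `<=` M].
Proof.
move=> kD oO cO Dx0 nOx0.
(* Adding [O] to every candidate lets the union of the empty chain satisfy [P]. *)
pose P A := [/\ open (A `|` O), convex_in ((A `|` O) `&` D) & ~ (D `<=` A `|` O)].
have [|A [[oA cA nA] maxA]] := @Zorn_bigcup _ P.
  move=> F FP tot.
  have [F0|F0] := eqVneq F set0.
    rewrite F0 bigcup_set0 /P set0U; split=> // DO; exact/nOx0/DO.
  move/set0P: F0 => F0; have [A0 FA0] := F0.
  have E : \bigcup_(A in F) A `|` O = \bigcup_(A in F) (A `|` O).
    apply/seteqP; split=> h.
      by move=> [[A FA Ah]|Oh]; [exists A => //; left|exists A0 => //; right].
    by move=> [A FA [Ah|Oh]]; [left; exists A|right].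
  split.
  - by rewrite E; apply: bigcup_open => A /FP[].
  - by apply: convex_bigcup_chain => // A /FP[].
  - rewrite E => DF.
    have [||A /FP[_ _]//] := compact_directed_cover kD F0 _ _ DF.
      by move=> A /FP[].
    move=> A B FA FB; case: (tot A B FA FB) => AB; [exists B => //|exists A => //].
      by move=> h [[/AB|]|]; [left|right|].
    by move=> h [|[/AB|]]; [|left|right].
exists (A `|` O); split; [exact: oA|exact: subsetUr|exact: cA|exact: nA|].
move=> M oM AM cM; have [?|nD] := pselect (D `<=` M); [by left|right].
apply: contrapT => nMA; apply: (maxA M).
  split; first by move=> h Ah; apply: AM; left.
  by move=> MA; apply: nMA => h /MA; left.
have MO : M `|` O = M by apply/setUidPl => h Oh; apply: AM; right.
by rewrite /P MO.
Qed.

Lemma cvg_affine (T : Type) (F : set_system T) (FF : Filter F) (w : T -> R)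
    (k l c : R) : w @ F --> c -> (fun z => k * w z + l) @ F --> k * c + l.
Proof.
by move=> wc; apply: cvgD; [apply: cvgM => //; exact: cvg_cst|exact: cvg_cst].
Qed.

Lemma contraction_continuous u (t : R) :
  continuous (fun h : weak_star X => t *: h + (1 - t) *: u : weak_star X).
Proof.
apply: weak_star_continuous => x h.
exact: (@cvg_affine _ _ (nbhs_filter h) _ t _ _ (@ev_continuous R X x h)).
Qed.

(* Contractions towards a point of M pull M back to a strictly larger open
   convex set, hence map D into M. *)
Lemma maximal_contraction D M u v (t : R) : convex_in D -> open M ->
  convex_in (M `&` D) -> ~ (D `<=` M) ->
  (forall M', open M' -> M `<=` M' -> convex_in (M' `&` D) ->
      D `<=` M' \/ M' `<=` M) ->
  M u -> D u -> D v -> 0 <= t -> t < 1 -> M (t *: v + (1 - t) *: u).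
Proof.
move=> cD oM cM nDM maxM Mu Du.
have main : forall (t : R), 0 < t -> t < 1 ->
    forall v, D v -> M (t *: v + (1 - t) *: u).
  move=> s s0 s1.
  pose T h : weak_star X := s *: h + (1 - s) *: u.
  have TD h : D h -> D (T h) by move=> Dh; apply: cD; rewrite // ltW.
  have Tconv h k (r : R) : T (r *: h + (1 - r) *: k) = r *: T h + (1 - r) *: T k.
    by apply: weak_star_eq => x; rewrite /T !(ev_conv, evDl, evZl); ring.
  (* If [M'] contains [D], then [T] maps [D] into [M], as wanted; the other alternative of
     maximality is refuted below. *)
  pose M' := M `|` T @^-1` M.
  have oT : open (T @^-1` M) by apply: open_comp => // h _; exact: contraction_continuous.
  have MT h : M h -> D h -> M (T h).
    by move=> Mh Dh; have [] := cM h u s (conj Mh Dh) (conj Mu Du) (ltW s0) (ltW s1).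
  have M'D h : D h -> M' h -> M (T h) by move=> Dh [Mh|//]; exact: MT.
  have cM' : convex_in (M' `&` D).
    move=> h k r [M'h Dh] [M'k Dk] r0 r1; split; last exact: cD.
    right; rewrite /preimage /= Tconv.
    have [] // := cM (T h) (T k) r _ _ r0 r1; split;
      by [exact: M'D|exact: TD].
  have [DM'|M'M] := maxM M' (openU oM oT) (@subsetUl _ _ _) cM'.
    by move=> v' Dv'; apply: M'D => //; exact: DM'.
  (* On the segment from [u] to a point [w] outside [M], let [r] be the supremum of the parameters
     in [M]. It is not attained, as [M] is open, but [T] moves [seg r] back to [seg (s * r)] in [M],
     so [seg r] lies in [M'] and hence in [M]. *)
  exfalso; apply: nDM => w Dw; apply: contrapT => nMw.
  pose seg (r : R) : weak_star X := r *: w + (1 - r) *: u.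
  pose E := [set r : R | [/\ 0 <= r, r <= 1 & M (seg r)]].
  have seg0 : seg 0 = u by rewrite /seg scale0r add0r subr0 scale1r.
  have E0 : E 0 by split=> //; rewrite seg0.
  have Eub r : E r -> r <= 1 by case.
  have supE : has_sup E by split; [exists 0|exists 1].
  pose r := sup E.
  have r0 : 0 <= r by apply: ub_le_sup => //; case: supE.
  have r1 : r <= 1 by apply: ge_sup => //; exists 0.
  have cseg : continuous seg.
    apply: weak_star_continuous => x.
    rewrite (_ : (fun _ => _) = (fun q : R => q * ev w x + (1 - q) * ev u x)) // => q.
    apply: cvgD.
      by apply: cvgM; [exact: cvg_id|exact: cvg_cst].
    apply: cvgM; last exact: cvg_cst.
    by apply: cvgB; [exact: cvg_cst|exact: cvg_id].
  have seg1 : seg 1 = w by rewrite /seg subrr scale0r addr0 scale1r.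
  have beyond q : 0 <= q -> q <= 1 -> M (seg q) -> exists2 q', E q' & q < q'.
    move=> q0 q1 Mq.
    have q1' : q < 1.
      by rewrite lt_neqAle q1 andbT; apply/eqP => E1; apply: nMw; rewrite -seg1 -E1.
    have /nbhs_normP[d /= d0 hd] : nbhs q (seg @^-1` M).
      by apply: cseg; apply: open_nbhs_nbhs.
    pose m := Num.min (1 - q) (d / 2).
    have m0 : 0 < m by rewrite lt_min subr_gt0 q1' divr_gt0.
    have m1 : m <= 1 - q by rewrite ge_min lexx.
    have md : m <= d / 2 by rewrite ge_min lexx orbT.
    exists (q + m); last by rewrite ltrDl.
    split; [by rewrite addr_ge0 // ltW|lra|].
    by apply: hd; rewrite /= opprD addrA subrr sub0r normrN gtr0_norm //; lra.
  have below q : 0 <= q -> q < r -> M (seg q).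
    move=> q0 qr; have rq : 0 < r - q by rewrite subr_gt0.
    have [r' [r'0 r'1 Mr']] := sup_adherent rq supE.
    rewrite -/r (_ : r - (r - q) = q); last ring.
    move=> qr'.
    have r'p : 0 < r' by exact: le_lt_trans qr'.
    have Dr' : D (seg r') by exact: cD.
    have qr1 : q / r' <= 1 by rewrite ler_pdivrMr // mul1r ltW.
    have [] := cM (seg r') u (q / r') (conj Mr' Dr') (conj Mu Du) _ qr1.
      by rewrite divr_ge0 // ltW.
    suff -> : seg q = q / r' *: seg r' + (1 - q / r') *: u by [].
    apply: weak_star_eq => x.
    by rewrite /seg !(ev_conv, evDl, evZl); field; rewrite gt_eqF.
  have rp : 0 < r.
    have [|q Eq q0] := beyond 0 (lexx _) ler01; first by rewrite seg0.
    by rewrite (lt_le_trans q0) //; apply: ub_le_sup => //; case: supE.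
  have nMr : ~ M (seg r).
    move=> /(beyond r r0 r1)[q Eq]; apply/negP; rewrite -leNgt.
    by apply: ub_le_sup => //; case: supE.
  apply/nMr/M'M; right; rewrite /preimage /mkset.
  have -> : T (seg r) = seg (s * r).
    by apply: weak_star_eq => x; rewrite /T /seg !(ev_conv, evDl, evZl); ring.
  by apply: below; [rewrite mulr_ge0 // ltW|rewrite gtr_pMl].
move=> Dv; rewrite le_eqVlt => /orP[/eqP <- _|t0 t1].
  by rewrite scale0r add0r subr0 scale1r.
exact: main.
Qed.

End Convexity.

(** * Extreme points on the dual sphere and slices that reach it *)

Section Sphere.
Context {R : realType} {X : normedModType R} (N : X -> R).
Hypothesis hN : equivalent_norm N.
Implicit Types (h u v x : weak_star X) (a b : X).
Implicit Types (A B D O U : set (weak_star X)).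
Local Notation p := (dual_norm N).

Lemma conv_lt (y z c t : R) : y < c -> z < c -> 0 <= t -> t <= 1 ->
  t * y + (1 - t) * z < c.
Proof.
move=> yc zc t0 t1.
have : t * y + (1 - t) * z <= Num.max y z.
  have : y <= Num.max y z by rewrite le_max lexx.
  have : z <= Num.max y z by rewrite le_max lexx orbT.
  nra.
by move=> /le_lt_trans; apply; rewrite gt_max yc.
Qed.

Lemma convex_dual_ball (r : R) : convex_in [set h : weak_star X | p h <= r].
Proof.
move=> u v t; rewrite /mkset => ur vr t0 t1.
by rewrite (le_trans (dual_norm_conv hN _ _ t0 t1)) //; nra.
Qed.

Lemma closed_dual_ball (r : R) : closed [set h : weak_star X | p h <= r].
Proof. by apply: (compact_closed weak_star_hausdorff); exact: compact_dual_ball. Qed.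

Lemma slice_around_ball D x a (c r : R) : compact D -> convex_in D ->
  (forall h, D h -> p h <= 1) -> D x -> p x = 1 -> r < 1 -> c < ev x a ->
  exists a' (c' : R), c' < ev x a' /\
    forall h, D h -> ev h a <= c \/ p h <= r -> ev h a' < c'.
Proof.
move=> kD cD D1 Dx px r1 cx.
pose A := D `&` [set h : weak_star X | ev h a <= c].
pose B := D `&` [set h : weak_star X | p h <= r].
have nA : ~ A x by case=> _; rewrite /mkset; lra.
have nB : ~ B x by case=> _; rewrite /mkset px; lra.
have [] := @separation_joined _ _ A B x.
- exact: (compact_closedI kD (@closed_ev_le _ _ _ _)).
- exact: (compact_closedI kD (@closed_dual_ball r)).
- exact: (convex_inI cD (@convex_ev_le _ _ _ _)).
- exact: (convex_inI cD (@convex_dual_ball _)).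
- exact: nA.
- exact: nB.
(* In [x = t u + (1 - t) v] with [p u <= 1] and [p v <= r < 1], the equality [p x = 1] forces
   [t = 1], so [x = u] would lie in [A]. *)
- move=> [u [v [t [Au [_ pv] t0 t1 xE]]]].
  rewrite /mkset in pv; have pu := D1 u Au.1.
  have := dual_norm_conv hN u v t0 t1; rewrite -xE px => le.
  have tE : t = 1 by nra.
  by apply: nA; rewrite xE tE subrr scale0r addr0 scale1r.
move=> a' [c' [lt ce]]; exists a', c'; split=> // h Dh hAB.
by apply: lt; case: hAB => ?; [left|right].
Qed.

(* The open set is an increasing union of slices of D: each one swallows the
   previous one together with a larger ball {p <= 1 - 1/(n+1)}. *)
Lemma open_convex_around_ball D x : compact D -> convex_in D ->
  (forall h, D h -> p h <= 1) -> D x -> p x = 1 ->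
  exists O, [/\ open O, convex_in (O `&` D),
    forall h, D h -> p h < 1 -> O h & ~ O x].
Proof.
move=> kD cD D1 Dx px.
have step (z : nat * (X * R)) : exists z' : X * R, z.2.2 < ev x z.2.1 ->
    z'.2 < ev x z'.1 /\ forall h, D h ->
      ev h z.2.1 <= z.2.2 \/ p h <= 1 - z.1.+1%:R^-1 -> ev h z'.1 < z'.2.
  (* The pair [(0, 0)] is a dummy value making the choice function total. *)
  have [lt|nlt] := pselect (z.2.2 < ev x z.2.1); last by exists (0, 0).
  have [|a' [c' [ca hc]]] := @slice_around_ball D x z.2.1 z.2.2
      (1 - z.1.+1%:R^-1) kD cD D1 Dx px _ lt.
    by rewrite gtrBl invr_gt0.
  by exists (a', c').
have [next hnext] := choice step.
(* The start [(0, -1)] is the empty half-space, which trivially excludes [x]. *)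
pose s := fix s n : X * R := if n is m.+1 then next (m, s m) else (0, -1).
have sx n : (s n).2 < ev x (s n).1.
  by elim: n => [|n IH] /=; [rewrite ev0r ltrN10|exact: (hnext (n, s n) IH).1].
have sS n h : D h -> ev h (s n).1 <= (s n).2 \/ p h <= 1 - n.+1%:R^-1 ->
    ev h (s n.+1).1 < (s n.+1).2.
  by move=> Dh hh; exact: (hnext (n, s n) (sx n)).2.
have mono n m h : D h -> ev h (s n).1 < (s n).2 ->
    ev h (s (n + m)%N).1 < (s (n + m)%N).2.
  move=> Dh lt; elim: m => [|m IH]; first by rewrite addn0.
  by rewrite addnS; apply: sS => //; left; exact: ltW.
pose O := \bigcup_n [set h : weak_star X | ev h (s n).1 < (s n).2].
exists O; split.
- by apply: bigcup_open => n _; exact: open_ev_lt.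
- move=> u v t [[n _ un] Du] [[m _ vm] Dv] t0 t1; split; last exact: cD.
  exists (n + m)%N => //; rewrite /mkset ev_conv.
  by apply: conv_lt => //; [exact: mono|rewrite addnC; exact: mono].
- move=> h Dh h1; have [k hk] := ltr_add_invr h1.
  exists k.+1 => //; apply: sS => //; right.
  by rewrite lerBrDr ltW.
- by move=> [n _]; rewrite /mkset; have := sx n; lra.
Qed.

(** A maximal [M] omits exactly one point [e] of [D]. Convexity of [M] within [D] makes [e] extreme,
    and [p e = 1] because [M] contains the part of [D] in the open ball. *)
Lemma extreme_on_sphere D x : compact D -> convex_in D ->
  (forall h, D h -> p h <= 1) -> D x -> p x = 1 ->
  exists e, [/\ D e, p e = 1 & convex_in (D `\ e)].
Proof.
move=> kD cD D1 Dx px.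
have [W [oW cW W1 nWx]] := open_convex_around_ball kD cD D1 Dx px.
have [M [oM OM cM nDM maxM]] := maximal_open_convex kD oW cW Dx nWx.
have [e De nMe] : exists2 e, D e & ~ M e.
  apply: contrapT => no; apply: nDM => h Dh; apply: contrapT => nMh.
  by apply: no; exists h.
have MD h : D h -> h <> e -> M h.
  move=> Dh he; apply: contrapT => nMh.
  have [b eb] := weak_star_neq_lt (fun eh => he (esym eh)).
  (* A half-space containing [e] but not [h]. If [h] were also outside [M], the open set formed by
     [M] and [V] would be convex in [D] and contradict maximality. *)
  pose V := [set k : weak_star X | ev k b < ev h b].
  (* Unless the mixture is [v] itself, it is a proper contraction towards a point of [M], so it lies
     in [M]. *)
  have mix u v (t : R) : M u -> D u -> V v -> D v -> 0 <= t -> t <= 1 ->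
      (M `|` V) (t *: u + (1 - t) *: v).
    move=> Mu Du Vv Dv t0 t1; have [->|tn0] := eqVneq t 0.
      by right; rewrite scale0r add0r subr0 scale1r.
    left; rewrite [_ *: u + _]addrC.
    have := @maximal_contraction _ _ D M u v (1 - t) cD oM cM nDM maxM Mu Du Dv.
    rewrite (_ : 1 - (1 - t) = t); last by ring.
    by apply; rewrite ?subr_ge0 // gtrBl lt0r tn0.
  have [|||DMV|] := maxM (M `|` V).
  - by apply: openU => //; exact: open_ev_lt.
  - exact: subsetUl.
  - move=> u v t [MVu Du] [MVv Dv] t0 t1; split; last exact: cD.
    case: MVu MVv => [Mu|Vu] [Mv|Vv].
    + by left; have [] := cM u v t (conj Mu Du) (conj Mv Dv) t0 t1.
    + exact: mix.
    + rewrite [_ *: u + _]addrC -[X in _ + X *: u](_ : 1 - (1 - t) = t); last by ring.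
      by apply: mix => //; rewrite ?subr_ge0 ?gerBl.
    + right; move: Vu Vv; rewrite /V /mkset ev_conv => ub vb; exact: conv_lt.
  - by have [//|] := DMV h Dh; rewrite /V /mkset ltxx.
  - by move=> MVM; apply: nMe; apply: MVM; right.
exists e; split=> //.
  apply/eqP; rewrite eq_le D1 //= leNgt; apply/negP => lt.
  exact/nMe/OM/W1.
move=> u v t [Du ue] [Dv ve] t0 t1; split; first exact: cD.
move=> E; apply: nMe; rewrite -E.
by have [] := cM u v t (conj (MD u Du ue) Du) (conj (MD v Dv ve) Dv) t0 t1.
Qed.

(** A slice around an extreme point of the intersection is small on the intersection only;
    compactness carries this over to some finite stage [j]. *)
Lemma separating_slice (D_ : nat -> set (weak_star X)) x :
  (forall j, compact (D_ j)) -> (forall j, convex_in (D_ j)) ->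
  (forall j, D_ j 0) -> (forall j, D_ j.+1 `<=` D_ j) ->
  (forall h, D_ 0%N h -> p h <= 1) ->
  (forall j, D_ j x) -> p x = 1 ->
  forall G : set (set (weak_star X)),
  (forall V, G V -> open V) -> (forall h, p h = 1 -> exists2 V, G V & V h) ->
  exists e j a (c : R), [/\ forall i, D_ i e, N a <= 1, 0 <= c, c < ev e a &
    exists2 V, G V & forall h, D_ j h -> c < ev h a -> V h].
Proof.
move=> kD cD D0 dec D1 Dx px G oG cG.
have decn i j : (i <= j)%N -> D_ j `<=` D_ i.
  move=> /subnK <-; elim: (j - i)%N => [|k IH] //= h.
  by rewrite addSn => /dec/IH.
pose D := \bigcap_j D_ j.
have clD j : closed (D_ j) by exact: (compact_closed weak_star_hausdorff).
have kDD : compact D.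
  apply: subclosed_compact (kD 0%N) _; last by move=> h; exact.
  by apply: closed_bigI => j _.
have cDD : convex_in D.
  by move=> u v t Du Dv t0 t1 j _; apply: cD => //; [exact: Du|exact: Dv].
have [e [De pe cDe]] := extreme_on_sphere kDD cDD (fun h Dh => D1 h (Dh 0%N I))
  (fun j _ => Dx j) px.
have [V GV Ve] := cG e pe.
have e0 : e <> 0.
  move=> e0; have [_ [c [C [c0 _ cN]]]] := hN; move: pe; rewrite e0.
  by have := dual_normZ hN 0 0; rewrite scale0r normr0 mul0r => ->; lra.
(* Deleting [0] from [V] forces [c >= 0], because [0] lies in every stage. *)
have nV : nbhs e (V `\ (0 : weak_star X)).
  apply: filterI; first exact: (open_nbhs_nbhs (conj (oG V GV) Ve)).
  apply: (open_nbhs_nbhs (conj _ e0)); apply: closed_openC.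
  exact: (accessible_closed_set1 (hausdorff_accessible weak_star_hausdorff)).
have [a [c [ce slice]]] := slice_nbhs kDD cDD cDe De nV.
have c0 : 0 <= c.
  rewrite leNgt; apply/negP => c0.
  have [|_] := slice 0 (fun j _ => D0 j); first by rewrite ev0l.
  exact.
(* The higher threshold leaves room for a closed, hence compact, slice inside the open one. *)
pose c' := (c + ev e a) / 2.
have cc' : c < c' by rewrite /c'; lra.
have c'e : c' < ev e a by rewrite /c'; lra.
have [|||||j _ Oj] := @compact_directed_cover _
    (D_ 0%N `&` [set h : weak_star X | c' <= ev h a]) nat setT
    (fun j => ~` D_ j `|` V).
- exact: (compact_closedI (kD _) (@closed_ev_ge _ _ _ _)).
- by exists 0%N.
- by move=> j _; apply: openU (oG V GV); exact: closed_openC.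
- move=> i j _ _; exists (maxn i j) => //.
  move=> h [[nD|]|[nD|]]; try by right.
    by left=> /(decn _ _ (leq_maxl i j)).
  by left=> /(decn _ _ (leq_maxr i j)).
- move=> h [_ ch]; rewrite /mkset in ch.
  have [Dh|nDh] := pselect (D h).
    by exists 0%N => //; right; have [] := slice h Dh (lt_le_trans cc' ch).
  have [j nj] : exists j, ~ D_ j h.
    apply: contrapT => no; apply: nDh => j _; apply: contrapT => nj.
    by apply: no; exists j.
  by exists j => //; left.
(* Rescaling by [N a + 1] gives a functional of norm at most 1 and also covers [N a = 0]. *)
have N1 : 0 < N a + 1 by rewrite ltr_wpDl // norm_ge0.
exists e, j, ((N a + 1)^-1 *: a), (c' / (N a + 1)).
have sc h : (c' / (N a + 1) < ev h ((N a + 1)^-1 *: a)) = (c' < ev h a).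
  by rewrite evZr mulrC ltr_pM2l // invr_gt0.
split.
- by move=> i; exact: De.
- by rewrite normZ // gtr0_norm ?invr_gt0 // ler_pdivrMl // mulr1 lerDl.
- by rewrite divr_ge0 // ?(ltW N1) // (le_trans c0) // ltW.
- by rewrite sc.
exists V => // h Dh; rewrite sc => ch.
by have [] := Oj h (conj (decn 0%N j (leq0n _) h Dh) (ltW ch)).
Qed.

End Sphere.

(** * Atomic norms and l2-combinations *)

Section AtomicNorm.
Context {R : realType} {X : normedModType R} (N : X -> R).
Hypothesis hN : equivalent_norm N.
Implicit Types (a b x y : X) (f : dual X).

Inductive atomic (A : set X) : X -> R -> Prop :=
| atomic0 : atomic A 0 0
| atomicS a x (k r : R) : A a -> atomic A x r ->
    atomic A (k *: a + x) (`|k| + r).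

Lemma atomicD (A : set X) x y (r s : R) :
  atomic A x r -> atomic A y s -> atomic A (x + y) (r + s).
Proof.
move=> Ax Ay; elim: Ax => [|a z k t Aa _ IH]; first by rewrite !add0r.
by rewrite -!addrA; exact: atomicS.
Qed.

Lemma atomicZ (A : set X) x (r k : R) :
  atomic A x r -> atomic A (k *: x) (`|k| * r).
Proof.
elim=> [|a z l t Aa _ IH]; first by rewrite scaler0 mulr0; exact: atomic0.
by rewrite scalerDr scalerA mulrDr -normrM; exact: atomicS.
Qed.

Lemma atomic_ge0 (A : set X) x (r : R) : atomic A x r -> 0 <= r.
Proof. by elim=> [|a z k t _ _ t0] //; rewrite addr_ge0. Qed.

Lemma atomic_ev (A : set X) x (r M : R) f :
  (forall a, A a -> `|ev f a| <= M) -> atomic A x r -> `|ev f x| <= M * r.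
Proof.
move=> fA; elim=> [|a z k t Aa _ IH]; first by rewrite ev0r normr0 mulr0.
rewrite evDr evZr (le_trans (ler_normD _ _)) // mulrDr lerD // normrM mulrC.
by rewrite ler_wpM2r // fA.
Qed.

Lemma atomic_norm_le (A : set X) x (r : R) :
  (forall a, A a -> N a <= 1) -> atomic A x r -> N x <= r.
Proof.
move=> NA; elim=> [|a z k t Aa _ IH]; first by rewrite norm_zero.
have [[ND NZ _] _] := hN.
by rewrite (le_trans (ND _ _)) // lerD // NZ ler_piMr // NA.
Qed.

(** The gauge of the absolutely convex hull of [A], since [atomic] records the l1 cost of a finite
    combination of elements of [A]. *)
Definition atomic_norm (A : set X) x : R := inf [set r | atomic A x r].

Section Absorbing.
Context (A : set X) (C : R).
Hypothesis (C0 : 0 < C) (NA : forall a, A a -> N a <= 1).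
Hypothesis absorbA : forall b, N b <= 1 -> A (C^-1 *: b).

Lemma atomic_absorb x : atomic A x (C * N x).
Proof.
have [Nx0|Nx0] := eqVneq (N x) 0.
  have [[_ _ /(_ x Nx0) ->] _] := hN.
  by rewrite norm_zero // mulr0; exact: atomic0.
have Nx : 0 < N x by rewrite lt0r Nx0 norm_ge0.
have Ax : A (C^-1 *: ((N x)^-1 *: x)).
  apply: absorbA; rewrite normZ // ger0_norm ?mulVf //.
  by rewrite invr_ge0 ltW.
have := atomicS (C * N x) Ax (atomic0 A).
rewrite !addr0 ger0_norm ?mulr_ge0 ?ltW // !scalerA.
rewrite (_ : C * N x * (C^-1 * (N x)^-1) = 1) ?scale1r //.
by field; rewrite Nx0 gt_eqF.
Qed.

Lemma atomic_norm_inf x : has_inf [set r | atomic A x r].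
Proof.
split; first by exists (C * N x); exact: atomic_absorb.
by exists 0 => r /atomic_ge0.
Qed.

Lemma atomic_norm_lb x (r : R) : atomic A x r -> atomic_norm A x <= r.
Proof. by move=> Ar; apply: ge_inf => //; case: (atomic_norm_inf x). Qed.

Lemma le_atomic_norm x (r : R) :
  (forall s, atomic A x s -> r <= s) -> r <= atomic_norm A x.
Proof. by move=> rs; apply: lb_le_inf => //; case: (atomic_norm_inf x). Qed.

Lemma atomic_norm_ev f (M : R) x : 0 <= M ->
  (forall a, A a -> `|ev f a| <= M) -> `|ev f x| <= M * atomic_norm A x.
Proof.
rewrite le_eqVlt => /predU1P[<-|M0] fA.
  rewrite mul0r -(mul0r (C * N x)); exact: atomic_ev fA (atomic_absorb x).
rewrite -ler_pdivrMl //; apply: le_atomic_norm => s As.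
by rewrite ler_pdivrMl //; exact: atomic_ev As.
Qed.

(** The gauge lies between [N], because atoms have norm at most 1, and [C * N], because [A] absorbs
    the unit ball. *)
Lemma equivalent_atomic_norm : equivalent_norm (atomic_norm A).
Proof.
have NAN x : N x <= atomic_norm A x.
  by apply: le_atomic_norm => s; exact: atomic_norm_le.
have [[_ _ N0] [c [D [c0 D0 cN]]]] := hN.
have nN x : 0 <= atomic_norm A x by rewrite (le_trans _ (NAN x)) // norm_ge0.
have leZ (k : R) x : atomic_norm A (k *: x) <= `|k| * atomic_norm A x.
  have [->|k0] := eqVneq k 0.
    rewrite scale0r normr0 mul0r; apply: atomic_norm_lb; exact: atomic0.
  rewrite -ler_pdivrMl ?normr_gt0 //; apply: le_atomic_norm => s As.
  by rewrite ler_pdivrMl ?normr_gt0 //; apply: atomic_norm_lb; exact: atomicZ.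
split; first split.
- move=> x y; rewrite -lerBlDr; apply: le_atomic_norm => s As.
  rewrite lerBlDr -lerBlDl; apply: le_atomic_norm => t At.
  by rewrite lerBlDl; apply: atomic_norm_lb; exact: atomicD.
- move=> k x; apply/eqP; rewrite eq_le leZ /=.
  have [->|k0] := eqVneq k 0; first by rewrite normr0 mul0r.
  rewrite -ler_pdivlMl ?normr_gt0 // -normfV.
  by have := leZ k^-1 (k *: x); rewrite scalerA mulVf // scale1r.
- move=> x x0; apply: N0; apply/eqP; rewrite eq_le norm_ge0 // andbT.
  by rewrite -x0.
exists c, (C * D); split=> // [|x]; first by rewrite mulr_gt0.
split; first by rewrite (le_trans (cN x).1).
rewrite (le_trans (atomic_norm_lb (atomic_absorb x))) // -mulrA ler_pM2l //.
exact: (cN x).2.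
Qed.

(** With [ev_le_dual_atomic_norm] this identifies the dual norm of the gauge as the supremum of
    [|f a|] over atoms. Norms built this way are dual norms by construction. *)
Lemma dual_atomic_norm_le f (M : R) : 0 <= M ->
  (forall a, A a -> `|ev f a| <= M) -> dual_norm (atomic_norm A) f <= M.
Proof.
move=> M0 fA; apply: dual_norm_le; first exact: equivalent_atomic_norm.
by move=> x Nx; rewrite (le_trans (atomic_norm_ev x M0 fA)) // ler_piMr.
Qed.

Lemma ev_le_dual_atomic_norm f a : A a ->
  `|ev f a| <= dual_norm (atomic_norm A) f.
Proof.
move=> Aa; apply: le_dual_norm; first exact: equivalent_atomic_norm.
apply: atomic_norm_lb; have := atomicS 1 Aa (atomic0 A).
by rewrite !addr0 normr1 scale1r.
Qed.

End Absorbing.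
End AtomicNorm.

Section WeightedSum.
Context {R : realType} {X : normedModType R} (N : X -> R).
Hypothesis hN : equivalent_norm N.
Context (Q : nat -> set X).
Hypothesis (Q1 : forall i b, Q i b -> N b <= 1) (Qn0 : forall i, Q i !=set0).
Hypothesis Q0 : forall b, N b <= 1 -> Q 0 b.
Implicit Types (a b : X) (x y z f : dual X).

Definition sup_on (B : set X) f : R := sup [set `|ev f b| | b in B].

Lemma has_sup_on i f : has_sup [set `|ev f b| | b in Q i].
Proof.
split; first by have [b Qb] := Qn0 i; exists `|ev f b|, b.
by exists (dual_norm N f) => _ [b Qb <-]; apply: le_dual_norm => //; exact: Q1 Qb.
Qed.

Lemma le_sup_on i f b : Q i b -> `|ev f b| <= sup_on (Q i) f.
Proof. by move=> Qb; apply: ub_le_sup; [case: (has_sup_on i f)|exists b]. Qed.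

Lemma sup_on_le i f (M : R) :
  (forall b, Q i b -> `|ev f b| <= M) -> sup_on (Q i) f <= M.
Proof.
by move=> le; apply: ge_sup; [case: (has_sup_on i f)|move=> _ [b Qb <-]; exact: le].
Qed.

Lemma sup_on_ge0 i f : 0 <= sup_on (Q i) f.
Proof. by have [b Qb] := Qn0 i; rewrite (le_trans _ (le_sup_on f Qb)). Qed.

Lemma sup_onZ i (k : R) f : sup_on (Q i) (k *: f) = `|k| * sup_on (Q i) f.
Proof.
have le (l : R) g : sup_on (Q i) (l *: g) <= `|l| * sup_on (Q i) g.
  by apply: sup_on_le => b Qb; rewrite evZl normrM ler_wpM2l // le_sup_on.
apply/eqP; rewrite eq_le le /=.
have [->|k0] := eqVneq k 0; first by rewrite normr0 mul0r sup_on_ge0.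
rewrite -ler_pdivlMl ?normr_gt0 // -normfV.
by have := le k^-1 (k *: f); rewrite scalerA mulVf // scale1r.
Qed.

Lemma sup_on_mid i x y :
  sup_on (Q i) (2^-1 *: (x + y)) <= (sup_on (Q i) x + sup_on (Q i) y) / 2.
Proof.
apply: sup_on_le => b Qb; rewrite evZl evDl normrM gtr0_norm ?invr_gt0 //.
rewrite mulrC ler_pM2r ?invr_gt0 // (le_trans (ler_normD _ _)) //.
by apply: lerD; exact: le_sup_on.
Qed.

Definition weight (i : nat) : R := 2^-1 ^+ i.+1.

Lemma weight_gt0 i : 0 < weight i. Proof. by rewrite exprn_gt0 // invr_gt0. Qed.

Lemma sum_weight n : \sum_(i < n) weight i = 1 - 2^-1 ^+ n.
Proof.
elim: n => [|n IH]; first by rewrite big_ord0 expr0 subrr.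
by rewrite big_ord_recr /= IH /weight exprS; field.
Qed.

Lemma sum_weight_le1 n : \sum_(i < n) weight i <= 1.
Proof. by rewrite sum_weight gerBl exprn_ge0 // invr_ge0. Qed.

(** Pairing [f] with such an atom gives the sum of [weight i * t i * f (b i)]. Its supremum over the
    weighted l2 ball of [t] and over the [b i] is the l2-combination of the seminorms. *)
Definition weighted_atoms : set X :=
  [set a | exists n (t : nat -> R) (b : nat -> X),
    [/\ forall i, Q i (b i), \sum_(i < n) weight i * t i ^+ 2 <= 1 &
        a = \sum_(i < n) (weight i * t i) *: b i]].

Lemma ev_sum f n (k : nat -> R) (b : nat -> X) :
  ev f (\sum_(i < n) k i *: b i) = \sum_(i < n) k i * ev f (b i).
Proof.
elim: n => [|n IH]; first by rewrite !big_ord0 ev0r.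
by rewrite !big_ord_recr /= evDr evZr IH.
Qed.

Lemma weighted_atoms_norm a : weighted_atoms a -> N a <= 1.
Proof.
move=> [n [t [b [Qb t1 ->]]]].
have [[ND NZ _] _] := hN.
have le m : N (\sum_(i < m) (weight i * t i) *: b i) <=
    \sum_(i < m) weight i * `|t i|.
  elim: m => [|m IH]; first by rewrite !big_ord0 norm_zero.
  rewrite !big_ord_recr /= (le_trans (ND _ _)) // lerD // NZ normrM.
  rewrite gtr0_norm ?weight_gt0 // ler_piMr //; last exact: Q1 (Qb m).
  by rewrite mulr_ge0 // ltW // weight_gt0.
rewrite (le_trans (le n)) //.
(* From [|t| <= (1 + t ^ 2) / 2]; the weights and the weighted squares each sum to at most 1. *)
have : \sum_(i < n) weight i * `|t i| <=
    \sum_(i < n) (weight i / 2 + weight i * t i ^+ 2 / 2).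
  apply: ler_sum => i _; have := weight_gt0 i.
  rewrite -(real_normK (num_real (t i))); set v := `|t i|.
  have := sqr_ge0 (v - 1); nra.
rewrite big_split /= -!mulr_suml; have := sum_weight_le1 n; lra.
Qed.

Lemma weighted_atoms_absorb b : N b <= 1 -> weighted_atoms (2^-1 *: b).
Proof.
move=> Nb; have [pt Qpt] := choice Qn0.
(* A single summand, whose weight is [1 / 2]; the later [b i] are arbitrary points of [Q i]. *)
exists 1%N, (fun=> 1), (fun i => if i is 0 then b else pt i); split.
- by case=> [|i]; [exact: Q0|exact: Qpt].
- by rewrite big_ord1 /weight expr1 expr1n mulr1 invf_le1 // ler1n.
- by rewrite big_ord1 /weight expr1 mulr1.
Qed.

Definition weighted_norm : dual X -> R :=
  dual_norm (atomic_norm weighted_atoms).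

Lemma equivalent_weighted_norm :
  equivalent_norm (atomic_norm weighted_atoms).
Proof.
exact: (equivalent_atomic_norm hN (ltr0Sn R 1) weighted_atoms_norm weighted_atoms_absorb).
Qed.

(* The weighted norm is the l2-combination of the seminorms sup_on (Q i):
   the two inclusions are Cauchy-Schwarz and its equality case. *)
Lemma sum_le_weighted_norm f n :
  \sum_(i < n) weight i * sup_on (Q i) f ^+ 2 <= weighted_norm f ^+ 2.
Proof.
have q0 : 0 <= weighted_norm f by apply: dual_norm_ge0; exact: equivalent_weighted_norm.
have fin (b : nat -> X) : (forall i, Q i (b i)) ->
    \sum_(i < n) weight i * ev f (b i) ^+ 2 <= weighted_norm f ^+ 2.
  move=> Qb; set T2 := \sum_(i < n) _.
  have T20 : 0 <= T2.
    by apply: sumr_ge0 => i _; rewrite mulr_ge0 ?sqr_ge0 // ltW // weight_gt0.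
  have [->|T2n0] := eqVneq T2 0; first exact: sqr_ge0.
  pose T := Num.sqrt T2.
  have TT : T ^+ 2 = T2 by rewrite sqr_sqrtr.
  have T0 : 0 < T by rewrite sqrtr_gt0 lt0r T2n0.
  rewrite -TT ler_sqr ?nnegrE //; last exact: ltW.
  (* Coefficients proportional to [f (b i)]: the equality case of Cauchy-Schwarz. *)
  have At : weighted_atoms (\sum_(i < n) (weight i * (ev f (b i) / T)) *: b i).
    exists n, (fun i => ev f (b i) / T), b; split=> //.
    under eq_bigr do rewrite exprMn mulrA.
    by rewrite -mulr_suml -/T2 exprVn TT divff.
  have := ev_le_dual_atomic_norm hN (ltr0Sn R 1) weighted_atoms_norm
    weighted_atoms_absorb f At.
  rewrite (ev_sum f n (fun i => weight i * (ev f (b i) / T))).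
  have -> : \sum_(i < n) weight i * (ev f (b i) / T) * ev f (b i) = T.
    rewrite (eq_bigr (fun i : 'I_n => weight i * ev f (b i) ^+ 2 * T^-1)); last first.
      by move=> i _; ring.
    by rewrite -mulr_suml -/T2 -TT expr2 mulfK ?gt_eqF.
  by rewrite gtr0_norm.
apply/ler_addgt0Pr => e e0.
have near i : exists b, Q i b /\ sup_on (Q i) f ^+ 2 <= ev f b ^+ 2 + e.
  pose s := sup_on (Q i) f; have s0 : 0 <= s by exact: sup_on_ge0.
  (* With [s - d < v <= s] one has [s ^ 2 - v ^ 2 <= 2 * s * d <= e]; the [+ 1] keeps the
     denominator positive. *)
  have d0 : 0 < e / (2 * s + 1) by rewrite divr_gt0 // ltr_wpDl // mulr_ge0.
  have [_ [b Qb <-] lt] := sup_adherent d0 (has_sup_on i f).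
  exists b; split=> //; have le := le_sup_on f Qb.
  rewrite -[ev f b ^+ 2](real_normK (num_real _)) -/s.
  rewrite -[sup _]/s -/s in lt le *.
  have dE : e / (2 * s + 1) * (2 * s + 1) = e.
    by rewrite divfK // gt_eqF // ltr_wpDl // mulr_ge0.
  set d := e / (2 * s + 1) in d0 dE lt *.
  have v0 : 0 <= `|ev f b| by [].
  set v := `|ev f b| in v0 le lt *.
  nra.
have [b Qb] := choice near.
have := fin b (fun i => (Qb i).1) => le.
have : \sum_(i < n) weight i * sup_on (Q i) f ^+ 2 <=
    \sum_(i < n) (weight i * ev f (b i) ^+ 2 + weight i * e).
  by apply: ler_sum => i _; rewrite -mulrDr ler_pM2l ?weight_gt0 //; exact: (Qb i).2.
rewrite big_split /= -mulr_suml; have := sum_weight_le1 n; nra.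
Qed.

Lemma weighted_norm_le f (M : R) : 0 <= M ->
  (forall n, \sum_(i < n) weight i * sup_on (Q i) f ^+ 2 <= M ^+ 2) ->
  weighted_norm f <= M.
Proof.
move=> M0 hM; apply/ler_addgt0Pr => e e0; pose M' := M + e.
have M'0 : 0 < M' by rewrite ltr_wpDl.
apply: (dual_atomic_norm_le hN (ltr0Sn R 1) weighted_atoms_norm
  weighted_atoms_absorb (ltW M'0)).
move=> _ [n [t [b [Qb t1 ->]]]].
rewrite (ev_sum f n (fun i => weight i * t i)) (le_trans (ler_norm_sum _ _ _)) //.
(* Young's inequality [w * s <= w ^ 2 * M' / 2 + s ^ 2 / (2 * M')]; each half sums to at most
   [M' / 2]. Passing from [M] to [M'] allows the division. *)
have : \sum_(i < n) `|weight i * t i * ev f (b i)| <=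
    \sum_(i < n) (weight i * t i ^+ 2 * (M' / 2) +
      weight i * sup_on (Q i) f ^+ 2 * (M'^-1 / 2)).
  apply: ler_sum => i _; rewrite !normrM gtr0_norm ?weight_gt0 //.
  rewrite -[X in X <= _]mulrA -[X in _ <= X + _]mulrA -[X in _ <= _ + X]mulrA.
  rewrite -mulrDr ler_pM2l ?weight_gt0 //.
  have := le_sup_on f (Qb i); set s := sup_on _ _; set v := `|ev _ _| => vs.
  rewrite -(real_normK (num_real (t i))); set w := `|t i|.
  have w0 : 0 <= w := normr_ge0 _.
  apply: (le_trans (ler_wpM2l w0 vs)).
  rewrite -subr_ge0.
  have -> : w ^+ 2 * (M' / 2) + s ^+ 2 * (M'^-1 / 2) - w * s =
      (M' * w - s) ^+ 2 / (2 * M') by field; rewrite gt_eqF.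
  by rewrite divr_ge0 ?sqr_ge0 // mulr_ge0 // ltW.
move=> /le_trans; apply; rewrite big_split /= -!mulr_suml.
have h1 : (\sum_(i < n) weight i * t i ^+ 2) * (M' / 2) <= M' / 2.
  by rewrite ler_piMl // divr_ge0 // ltW.
have h2 : (\sum_(i < n) weight i * sup_on (Q i) f ^+ 2) * (M'^-1 / 2) <= M' / 2.
  have -> : M' / 2 = M' ^+ 2 * (M'^-1 / 2) by field; rewrite gt_eqF.
  apply: ler_wpM2r; first by rewrite divr_ge0 // invr_ge0 ltW.
  by rewrite (le_trans (hM n)) // ler_sqr ?nnegrE /M' ?lerDl // ltW.
by rewrite -/M'; lra.
Qed.

(** The convexity defect [d j] of each squared seminorm is at least a quarter of the squared
    difference. A positive defect at one index would push the norm of the midpoint strictly below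
    the common value. *)
Lemma weighted_norm_mid x y : weighted_norm x = weighted_norm y ->
  weighted_norm y = weighted_norm (2^-1 *: (x + y)) ->
  forall i, sup_on (Q i) x = sup_on (Q i) y /\
    sup_on (Q i) (2^-1 *: (x + y)) = sup_on (Q i) y.
Proof.
set z := 2^-1 *: (x + y) => qxy qyz i.
pose s j f := sup_on (Q j) f.
pose d j := (s j x ^+ 2 + s j y ^+ 2) / 2 - s j z ^+ 2.
have dge j : (s j x - s j y) ^+ 2 / 4 <= d j.
  have := sup_on_mid j x y; rewrite -/z -/(s j z) -/(s j x) -/(s j y).
  have := sup_on_ge0 j z; rewrite /d -/(s j z); nra.
have d0 j : 0 <= d j by rewrite (le_trans _ (dge j)) // divr_ge0 // sqr_ge0.
have q0 f : 0 <= weighted_norm f by apply: dual_norm_ge0; exact: equivalent_weighted_norm.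
have wi := weight_gt0 i.
have sum_le n : (i < n)%N ->
    \sum_(j < n) weight j * s j z ^+ 2 + weight i * d i <= weighted_norm y ^+ 2.
  move=> lin.
  have E : \sum_(j < n) weight j * s j z ^+ 2 + \sum_(j < n) weight j * d j =
      (\sum_(j < n) weight j * s j x ^+ 2 + \sum_(j < n) weight j * s j y ^+ 2) / 2.
    rewrite -!big_split mulr_suml; apply: eq_bigr => j _ /=.
    by rewrite /d; field.
  have : weight i * d i <= \sum_(j < n) weight j * d j.
    rewrite (bigD1 (Ordinal lin)) //= lerDl; apply: sumr_ge0 => j _.
    by rewrite mulr_ge0 // ltW // weight_gt0.
  have := sum_le_weighted_norm x n; have := sum_le_weighted_norm y n.
  rewrite qxy -/(s _ _); move: E; rewrite /s; lra.
have di : d i = 0.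
  apply/eqP; rewrite eq_le d0 andbT leNgt; apply/negP => di.
  have wd : 0 < weight i * d i by rewrite mulr_gt0.
  have sum0 n : 0 <= \sum_(j < n) weight j * s j z ^+ 2.
    by apply: sumr_ge0 => j _; rewrite mulr_ge0 ?sqr_ge0 // ltW // weight_gt0.
  pose M2 := weighted_norm y ^+ 2 - weight i * d i.
  have M20 : 0 <= M2.
    by have := sum_le i.+1 (ltnSn i); have := sum0 i.+1; rewrite /M2; lra.
  have : weighted_norm z <= Num.sqrt M2.
    apply: weighted_norm_le; first exact: sqrtr_ge0.
    move=> n; rewrite sqr_sqrtr // /M2 lerBrDr.
    (* The sum is lengthened so that it includes index [i]. *)
    apply: le_trans (sum_le (n + i.+1)%N (leq_addl _ _)); rewrite lerD2r.
    rewrite big_split_ord /= lerDl; apply: sumr_ge0 => j _.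
    by rewrite mulr_ge0 ?sqr_ge0 // ltW // weight_gt0.
  rewrite -ler_sqr ?nnegrE ?sqrtr_ge0 // sqr_sqrtr // -qyz /M2; lra.
have sxy : s i x = s i y.
  have := dge i; rewrite di pmulr_lle0 ?invr_gt0 // => le.
  apply/eqP; rewrite -subr_eq0 -sqrf_eq0 eq_le le; exact: sqr_ge0.
split=> //; apply/eqP; rewrite -(eqrXn2 (n := 2)) ?sup_on_ge0 //; apply/eqP.
move: di; rewrite /d sxy /s; lra.
Qed.

End WeightedSum.

(** * Derived sets of a cover *)

Section Derivation.
Context {R : realType} {X : normedModType R} (N : X -> R).
Hypothesis hN : equivalent_norm N.
Implicit Types (h u v x : weak_star X) (a b : X).
Implicit Types (A D V : set (weak_star X)) (G : set (set (weak_star X))).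
Local Notation p := (dual_norm N).

Lemma dual_normN h : p (- h) = p h.
Proof. by rewrite -scaleN1r dual_normZ // normrN1 mul1r. Qed.

Definition small_slices G A : set (X * R) :=
  [set z | [/\ N z.1 <= 1, 0 <= z.2 & exists2 V, G V &
     forall h, p h = 1 -> A h -> z.2 < ev h z.1 -> V h]].

(** The absolute value cuts away each slice together with its reflection, which keeps the derived
    sets symmetric. *)
Definition derivative G A : set (weak_star X) :=
  [set u | A u /\ forall z, small_slices G A z -> `|ev u z.1| <= z.2].

Definition derivatives G j : set (weak_star X) :=
  iter j (derivative G) [set h : weak_star X | p h <= 1].

Lemma derivativeE G A : derivative G A = A `&` \bigcap_(z in small_slices G A)
  ([set h : weak_star X | ev h z.1 <= z.2] `&` [set h : weak_star X | - z.2 <= ev h z.1]).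
Proof.
apply/seteqP; split=> [u [Au uz]|u [Au uz]]; split=> // z zs.
  by have := uz z zs; rewrite ler_norml => /andP[].
by have [+ +] := uz z zs; rewrite ler_norml => /= -> ->.
Qed.

Lemma compact_derivatives G j : compact (derivatives G j).
Proof.
elim: j => [|j IH]; first exact: compact_dual_ball.
rewrite /derivatives iterS -/(derivatives G j) derivativeE.
apply: compact_closedI => //; apply: closed_bigI => z _.
by apply: closedI; [exact: closed_ev_le|exact: closed_ev_ge].
Qed.

Lemma convex_derivatives G j : convex_in (derivatives G j).
Proof.
elim: j => [|j IH]; first exact: convex_dual_ball.
rewrite /derivatives iterS -/(derivatives G j) derivativeE.
apply: convex_inI => // u v t us vs t0 t1 z zs.
have [u1 u2] := us z zs; have [v1 v2] := vs z zs.
by split; [exact: convex_ev_le|exact: convex_ev_ge].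
Qed.

Lemma derivatives0 G j : derivatives G j 0.
Proof.
elim: j => [|j IH]; last by split=> // z [_ z0 _]; rewrite ev0l normr0.
by rewrite /derivatives /= -(scale0r 0) dual_normZ // normr0 mul0r.
Qed.

Lemma derivativesN G j h : derivatives G j h -> derivatives G j (- h).
Proof.
elim: j => [|j IH]; first by rewrite /derivatives /mkset /= dual_normN.
by move=> [Dh hz]; split=> [|z zs]; [exact: IH|rewrite evNl normrN; exact: hz].
Qed.

Lemma derivatives_exhaust G x :
  (forall V, G V -> open V) -> (forall h, p h = 1 -> exists2 V, G V & V h) ->
  p x = 1 -> exists j, derivatives G j x /\ ~ derivatives G j.+1 x.
Proof.
move=> oG cG px.
have [j nj] : exists j, ~ derivatives G j x.
  apply: contrapT => no.
  have all j : derivatives G j x.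
    by apply: contrapT => nj; apply: no; exists j.
  have [||e [j [a [c [De Na c0 ce [V GV slice]]]]]] :=
    @separating_slice _ _ N hN (derivatives G) x (@compact_derivatives G)
      (@convex_derivatives G) (@derivatives0 G) _ _ all px G oG cG.
  - by move=> j h [].
  - by [].
  have [_ hz] := De j.+1.
  have zs : small_slices G (derivatives G j) (a, c).
    by split=> //; exists V => // h _; exact: slice.
  have := le_lt_trans (hz _ zs) ce.
  by rewrite ltNge ler_norm.
elim: j nj => [|j IH] nj; first by case: nj; rewrite /derivatives /= px.
by have [Dj|/IH//] := pselect (derivatives G j x); exists j.
Qed.

(** The rescaling replaces the thresholds [z.2], which vary with the slice, by the common bound
    [1 / (k + 1)]. The atom [0] makes the family nonempty. *)
Definition slice_atoms G j k : set X :=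
  [set b | b = 0 \/ exists2 z, small_slices G (derivatives G j) z &
     b = (k.+1%:R^-1 / (z.2 + k.+1%:R^-1)) *: z.1].

Lemma slice_atoms_norm G j k b : slice_atoms G j k b -> N b <= 1.
Proof.
move=> [->|[z [Nz z0 _] ->]]; first by rewrite norm_zero.
have r0 : 0 < k.+1%:R^-1 :> R by rewrite invr_gt0.
rewrite normZ // ger0_norm; last by rewrite divr_ge0 ?addr_ge0 // ltW.
apply: mulr_ile1 => //; [by rewrite divr_ge0 ?addr_ge0 // ltW|exact: norm_ge0|].
by rewrite ler_pdivrMr ?mul1r ?lerDr // ltr_wpDl.
Qed.

Lemma slice_atoms_neq0 G j k : slice_atoms G j k !=set0.
Proof. by exists 0; left. Qed.

(** Triples (cover, stage, precision) are enumerated from index 1. Index 0 is the unit ball, whose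
    seminorm is the given dual norm; codes of no triple default to it as well. *)
Definition atom_family (G : nat -> set (set (weak_star X))) (i : nat) : set X :=
  if i is m.+1 then
    if unpickle m is Some (n, j, k) then slice_atoms (G n) j k
    else [set b | N b <= 1]
  else [set b | N b <= 1].

Lemma atom_family_norm (G : nat -> set (set (weak_star X))) i b :
  atom_family G i b -> N b <= 1.
Proof.
case: i => [//|m] /=; case: unpickle => [[[n j] k]|//].
exact: slice_atoms_norm.
Qed.

Lemma atom_family_neq0 (G : nat -> set (set (weak_star X))) i : atom_family G i !=set0.
Proof.
have N0 : [set b | N b <= 1] !=set0 by exists 0; rewrite /= norm_zero.
by case: i => [//|m] /=; case: unpickle => [[[n j] k]|//]; exact: slice_atoms_neq0.
Qed.

Lemma atom_familyE (G : nat -> set (set (weak_star X))) n j k :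
  atom_family G (pickle (n, j, k)).+1 = slice_atoms (G n) j k.
Proof. by rewrite /= pickleK. Qed.

(* Membership in the derived sets is read off the seminorms:
   |u b| <= r for every atom b = r a / (c + r) says |u a| <= c + r. *)
Lemma derivative_sup_on G j u : derivatives G j u ->
  (derivatives G j.+1 u <->
   forall k, sup_on (slice_atoms G j k) u <= k.+1%:R^-1).
Proof.
move=> Dj; split=> [[_ hz] k|le].
  have r0 : 0 < k.+1%:R^-1 :> R by rewrite invr_gt0.
  apply: ge_sup => [|_ [b [->|[z zs ->]] <-]].
  - by have [b Qb] := slice_atoms_neq0 G j k; exists `|ev u b|, b.
  - by rewrite ev0r normr0 ltW.
  have z0 : 0 <= z.2 by case: zs.
  rewrite evZr normrM ger0_norm; last by rewrite divr_ge0 ?addr_ge0 // ltW.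
  rewrite -mulrA ger_pMr // ler_pdivrMl ?mulr1 ?ltr_wpDl //.
  by rewrite (le_trans (hz z zs)) // lerDl ltW.
split=> // z zs; apply/ler_addgt0Pr => e e0.
have [k ke] := ltr_add_invr (e0 : 0 < e); rewrite add0r in ke.
apply: le_trans (_ : z.2 + k.+1%:R^-1 <= _); last by rewrite lerD2l ltW.
have r0 : 0 < k.+1%:R^-1 :> R by rewrite invr_gt0.
have z0 : 0 <= z.2 by case: zs.
have Qb : slice_atoms G j k ((k.+1%:R^-1 / (z.2 + k.+1%:R^-1)) *: z.1).
  by right; exists z.
have : `|ev u ((k.+1%:R^-1 / (z.2 + k.+1%:R^-1)) *: z.1)| <= k.+1%:R^-1.
  apply: le_trans (le k); apply: ub_le_sup; last first.
    by exists ((k.+1%:R^-1 / (z.2 + k.+1%:R^-1)) *: z.1).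
  exists (p u) => _ [b /slice_atoms_norm Nb <-]; exact: le_dual_norm.
rewrite evZr normrM ger0_norm; last by rewrite divr_ge0 ?addr_ge0 // ltW.
by rewrite -mulrA ger_pMr // ler_pdivrMl ?mulr1 ?ltr_wpDl.
Qed.

Lemma derivatives_sup_on G u v :
  p u <= 1 -> p v <= 1 ->
  (forall j k, sup_on (slice_atoms G j k) u = sup_on (slice_atoms G j k) v) ->
  forall j, derivatives G j u -> derivatives G j v.
Proof.
move=> pu pv uv; elim=> [//|j IH] Du.
have Dj : derivatives G j u by case: Du.
apply/(derivative_sup_on (IH Dj)) => k; rewrite -uv.
exact: (derivative_sup_on Dj).1.
Qed.

(* A nearly optimal atom for the midpoint z is nearly optimal for x and y. *)
Lemma common_slice G x y : (forall V, G V -> open V) ->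
  (forall h, p h = 1 -> exists2 V, G V & V h) ->
  p x = 1 -> p y = 1 -> p (2^-1 *: (x + y)) = 1 ->
  (forall j k, sup_on (slice_atoms G j k) x = sup_on (slice_atoms G j k) y) ->
  (forall j k, sup_on (slice_atoms G j k) (2^-1 *: (x + y)) =
     sup_on (slice_atoms G j k) y) ->
  exists2 V, G V & (V x /\ V y) \/ (V (- x) /\ V (- y)).
Proof.
set z := 2^-1 *: (x + y) => oG cG px py pz sxy szy.
have [j [Dz nDz]] := derivatives_exhaust oG cG pz.
have Dy : derivatives G j y by apply: derivatives_sup_on Dz; rewrite ?pz ?py.
have Dx : derivatives G j x by apply: derivatives_sup_on Dy; rewrite ?px ?py.
have [k nk] : exists k, k.+1%:R^-1 < sup_on (slice_atoms G j k) z.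
  apply: contrapT => no; apply/nDz/(derivative_sup_on Dz) => k.
  by rewrite leNgt; apply/negP => lt; apply: no; exists k.
set r : R := k.+1%:R^-1 in nk *; set s := sup_on _ z in nk *.
have r0 : 0 < r by rewrite invr_gt0.
have hs u : has_sup [set `|ev u b| | b in slice_atoms G j k].
  split; first by have [b Qb] := slice_atoms_neq0 G j k; exists `|ev u b|, b.
  exists (p u) => _ [b /slice_atoms_norm Nb <-]; exact: le_dual_norm.
(* Then [|z b| > (s + r) / 2]. As [x b] and [y b] are at most [s] in absolute value and average to
   [z b], both exceed [r], up to a common sign. *)
have d0 : 0 < (s - r) / 2 by rewrite divr_gt0 // subr_gt0.
have [_ [b Qb <-]] := sup_adherent d0 (hs z); rewrite -/(sup_on _ z) -/s => zb.
have ub u : sup_on (slice_atoms G j k) u = s -> `|ev u b| <= s.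
  by move=> <-; apply: ub_le_sup; [case: (hs u)|exists b].
have xs : `|ev x b| <= s by apply: ub; rewrite sxy -szy.
have ys : `|ev y b| <= s by apply: ub; rewrite -szy.
have zE : ev z b = (ev x b + ev y b) / 2 by rewrite evZl evDl mulrC.
case: Qb => [b0|[w [Nw w0 [V GV slice]] bE]].
  by move: zb; rewrite b0 ev0r normr0; lra.
have wr : 0 < w.2 + r by rewrite ltr_wpDl.
(* Undoing the rescaling, [r < u b] says that [u] exceeds [w.2 + r] at [w.1], so [u] lies in the
   small slice. *)
have inV u : p u = 1 -> derivatives G j u -> r < ev u b -> V u.
  move=> pu Du; rewrite bE evZr mulrAC ltr_pdivlMr // ltr_pM2l // => lt.
  by apply: slice => //; apply: lt_trans lt; rewrite ltrDl.
exists V => //; have [z0|z0] := leP 0 (ev z b).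
  left; move: zb; rewrite ger0_norm // zE => zb.
  by split; apply: inV => //; have := ler_norm (ev x b); have := ler_norm (ev y b); lra.
right; move: zb; rewrite ltr0_norm // zE => zb.
split; apply: inV; rewrite ?dual_normN ?evNl //; try exact: derivativesN.
  by have := ler_norm (- ev y b); rewrite normrN; lra.
by have := ler_norm (- ev x b); rewrite normrN; lra.
Qed.

End Derivation.

(** * From the semi-metric to the rotund norm *)

(** Members of [G n] are w*-open sets whose trace on the sphere lies in a ball of radius
    [1 / (n + 1)]. If one contains [x] and [y], the centre of that ball is close to both by
    symmetry, hence in disjoint half-spaces around them for large [n]; no triangle inequality is
    involved. *)
Lemma semi_metrizable_covers (R : realType) (X : normedModType R)
    (p : dual X -> R) : semi_metrizable R (set_type (dual_sphere p)) ->
  exists G : nat -> set (set (weak_star X)),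
  [/\ forall n V, G n V -> open V,
      forall n h, p h = 1 -> exists2 V, G n V & V h &
      forall x y, p x = 1 -> p y = 1 -> x <> y -> exists n,
        forall m V, (n <= m)%N -> G m V -> V x -> V y -> False].
Proof.
move=> [rho [[_ rho0 rhoC rhoE] _ ballN nbhsB]].
pose S := set_type (dual_sphere p).
pose val (s : S) : weak_star X := set_val s.
pose G n : set (set (weak_star X)) :=
  [set V | open V /\ exists z : S, forall s : S, V (val s) -> rho z s < n.+1%:R^-1].
have onS h : p h = 1 -> exists s : S, val s = h.
  by move=> ph; exists (exist _ h (mem_set ph)).
have nbhs_val (s : S) V : open V -> V (val s) -> nbhs s (val @^-1` V).
  move=> oV Vs; apply: (@initial_continuous _ _ (set_val : S -> weak_star X) s).
  exact: open_nbhs_nbhs.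
exists G; split.
- by move=> n V [].
- move=> n h /onS[s <-].
  have r0 : 0 < n.+1%:R^-1 :> R by rewrite invr_gt0.
  have [_ [[V oV <-] Vs] sub] := ballN s _ r0.
  by exists V => //; split=> //; exists s => s' /sub.
move=> _ _ /onS[sx <-] /onS[sy <-] xy.
have [a [c [xc cy]]] : exists a (c : R),
    (ev (val sx) a < c /\ c < ev (val sy) a).
  have [b lt] := weak_star_neq_lt xy.
  by exists b, ((ev (val sx) b + ev (val sy) b) / 2); split; lra.
have [e1 e10 B1] := nbhsB _ _ (nbhs_val sx _ (@open_ev_lt _ _ a c) xc).
have [e2 e20 B2] := nbhsB _ _ (nbhs_val sy _ (@open_ev_gt _ _ a c) cy).
have e0 : 0 < Num.min e1 e2 by rewrite lt_min e10.
have [n] := ltr_add_invr e0; rewrite add0r lt_min => /andP[n1 n2].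
exists n => m V nm [_ [z hz]] Vx Vy.
have mn : m.+1%:R^-1 <= n.+1%:R^-1 :> R by rewrite lef_pV2 ?posrE // ler_nat.
have : ev (val z) a < c.
  by apply: B1; rewrite /symmetric_ball /= rhoC (lt_trans (lt_le_trans (hz _ Vx) mn)).
have : c < ev (val z) a.
  by apply: B2; rewrite /symmetric_ball /= rhoC (lt_trans (lt_le_trans (hz _ Vy) mn)).
by move=> /lt_trans h /h; rewrite ltxx.
Qed.

Theorem corollary1p7 (R : realType) (X : completeNormedModType R)
  (p : dual X -> R) (hp : equivalent_dual_norm p)
  (hS : semi_metrizable R (set_type (dual_sphere p))) :
  exists q : dual X -> R, equivalent_dual_norm q /\ rotund q.
Proof.
have [G [oG cG sepG]] := semi_metrizable_covers hS.
have [N hN pE] := hp.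
pose Q := atom_family N G.
have Q1 i b : Q i b -> N b <= 1 by exact: atom_family_norm.
have Qn0 i : Q i !=set0 by exact: atom_family_neq0.
have Q0 b : N b <= 1 -> Q 0%N b by [].
exists (weighted_norm Q); split.
  exists (atomic_norm (weighted_atoms Q)) => //.
  exact: (equivalent_weighted_norm hN Q1 Qn0 Q0).
move=> x y qxy qyz; apply: contrapT => xy.
have mid := weighted_norm_mid hN Q1 Qn0 Q0 qxy qyz.
(* Index 0 of the family is the unit ball of [N], so its seminorm is [p]. *)
have [pxy pzy] : p x = p y /\ p (2^-1 *: (x + y)) = p y.
  by rewrite pE; exact: mid 0%N.
have [py0|py0] := eqVneq (p y) 0.
  have zero u : p u = 0 -> u = 0 by rewrite pE; exact: dual_norm_eq0.
  by apply: xy; rewrite (zero y py0); apply: zero; rewrite pxy.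
pose k := (p y)^-1.
have k0 : k != 0 by rewrite invr_eq0.
have p1 u : p u = p y -> p (k *: u) = 1.
  rewrite pE dual_normZ // -pE => ->.
  by rewrite ger0_norm ?mulVf // invr_ge0 pE dual_norm_ge0.
have zE : 2^-1 *: (k *: x + k *: y) = k *: (2^-1 *: (x + y)).
  by rewrite -scalerDr !scalerA mulrC.
have xy' : k *: x <> k *: y.
  by move=> /(congr1 (fun u => k^-1 *: u)); rewrite !scalerA mulVf // !scale1r.
have pN u : p u = 1 -> p (- u) = 1 by rewrite pE dual_normN.
have [n1 sep1] := sepG _ _ (p1 _ pxy) (p1 y erefl) xy'.
have [n2 sep2] := sepG _ _ (pN _ (p1 _ pxy)) (pN _ (p1 y erefl))
  (fun h => xy' (oppr_inj h)).
(* One cover that separates [k *: x] from [k *: y] and also their opposites, as [common_slice] may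
   return either pair. *)
pose n := maxn n1 n2.
have supQ j i u v : (forall m, sup_on (Q m) u = sup_on (Q m) v) ->
    sup_on (slice_atoms N (G n) j i) (k *: u) =
    sup_on (slice_atoms N (G n) j i) (k *: v).
  move=> uv; rewrite -atom_familyE -/Q.
  by rewrite !(sup_onZ hN Q1 Qn0) uv.
have [||||||V GV [[Vx Vy]|[Vx Vy]]] :=
  @common_slice _ _ N hN (G n) (k *: x) (k *: y) (oG n).
- by rewrite -pE; exact: cG.
- by rewrite -pE; exact: p1.
- by rewrite -pE; exact: p1.
- by rewrite zE -pE; exact: p1.
- by move=> j i; apply: supQ => m; case: (mid m).
- by move=> j i; rewrite zE; apply: supQ => m; case: (mid m).
- by apply: (sep1 n V) => //; exact: leq_maxl.
- by apply: (sep2 n V) => //; exact: leq_maxr.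
Qed.
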